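(* (Linear elastic energy density in quiescent regions.) Let $\mathbf{x}\in\Omega$ with $H_\epsilon(\mathbf{x})\subset\Omega$, let $F$ be a symmetric $d\times d$ matrix, and suppose that at time $t$ the bonds at $\mathbf{x}$ are undamaged, i.e. $\gamma(\mathbf{u})(\mathbf{y},\mathbf{x},t)=1$ for $\mathbf{y}\in H_\epsilon(\mathbf{x})$, and that the two point strain is $S(\mathbf{y},\mathbf{x},\mathbf{u}(t))=F\mathbf{e}\cdot\mathbf{e}<S^c:=r^c/\sqrt{|\mathbf{y}-\mathbf{x}|}$ for $\mathbf{y}\in H_\epsilon(\mathbf{x})$. Then the energy density satisfies $$W^\epsilon(\mathbf{x},\mathbf{u})=\int_\Omega\rho^\epsilon(\mathbf{y},\mathbf{x})\,g(r(t,\mathbf{u}))\,d\mathbf{y}=2\mu|F|^2+\lambda|\mathrm{Tr}\{F\}|^2+O(\epsilon|F|^4),$$ where $|F|^2=\sum_{ij}F_{ij}^2$ and $$\mu=\lambda=\frac18\,g''(0)\int_0^1 q^2J(q)\,dq\ \ (d=2),\qquad \mu=\lambda=\frac1{10}\,g''(0)\int_0^1 q^3J(q)\,dq\ \ (d=3).$$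
   Context: Let $d\in\{2,3\}$, $\Omega\subset\mathbb{R}^d$ a bounded domain, $\epsilon>0$, $H_\epsilon(\mathbf{x})=\{\mathbf{y}:|\mathbf{y}-\mathbf{x}|<\epsilon\}$, $\omega_d$ the volume of the unit ball. The kernel is $\rho^\epsilon(\mathbf{y},\mathbf{x})=\chi_\Omega(\mathbf{y})J(|\mathbf{y}-\mathbf{x}|/\epsilon)/(\epsilon\,\omega_d\epsilon^d)$, where $J:[0,\infty)\to[0,\infty)$ is decreasing, positive on $[0,1)$, $J(0)=M<\infty$, $J=0$ on $[1,\infty)$. Here $\mathbf{e}=(\mathbf{y}-\mathbf{x})/|\mathbf{y}-\mathbf{x}|$, $S(\mathbf{y},\mathbf{x},\mathbf{u}(t))=\frac{\mathbf{u}(t,\mathbf{y})-\mathbf{u}(t,\mathbf{x})}{|\mathbf{y}-\mathbf{x}|}\cdot\mathbf{e}$ and $r(t,\mathbf{u})=\sqrt{|\mathbf{y}-\mathbf{x}|}\,S(\mathbf{y},\mathbf{x},\mathbf{u}(t))$. The matrix $F$ plays the role of the symmetric gradient $(\nabla\mathbf{u}(t,\mathbf{x})+\nabla\mathbf{u}(t,\mathbf{x})^T)/2$. The energy density is $W^\epsilon(\mathbf{x},\mathbf{u})=\int_\Omega\rho^\epsilon(\mathbf{y},\mathbf{x})\gamma(\mathbf{u})(\mathbf{y},\mathbf{x},t)g(r(t,\mathbf{u}))\,d\mathbf{y}$, where $\gamma\in[0,1]$ is the degradation factor of the bond. The potential has the form $g(r)=f(r^2)$, where $f$ is strictly increasing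 and concave up to the threshold at which $g$ becomes constant, $f(0)=0$; $g$ is bounded with bounded $g',g''$ and constant equal to $g_\infty$ for $r\ge r^+$; $g$ is four times continuously differentiable near $0$ with $g'(0)=g'''(0)=0$. The constant $r^c\in(0,r^+)$ is the inflection point of $g$ for $r>0$. The $O(\epsilon|F|^4)$ term is bounded by a constant (independent of $\epsilon$, $F$, $\mathbf{x}$) times $\epsilon|F|^4$. *)

(* Defs.v *)
From HB Require Import structures.
From mathcomp Require Import all_boot all_order all_algebra.
From mathcomp Require Import all_classical all_reals all_analysis.

Set Implicit Arguments.
Unset Strict Implicit.
Unset Printing Implicit Defensive.
Import Order.TTheory GRing.Theory Num.Theory numFieldNormedType.Exports.

Local Open Scope classical_set_scope.
Local Open Scope ring_scope.

Section measurable_cV.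
Variables (R : realType) (n : nat).

Let coor (i : 'I_n) (x : 'cV[R]_n) : R := x i ord0.

Let cV_set0 : g_sigma_preimage coor set0.
Proof. exact: sigma_algebra0. Qed.

Let cV_setC A : g_sigma_preimage coor A -> g_sigma_preimage coor (~` A).
Proof. exact: sigma_algebraC. Qed.

Let cV_bigcup (F : _^nat) : (forall i, g_sigma_preimage coor (F i)) ->
  g_sigma_preimage coor (\bigcup_i (F i)).
Proof. exact: sigma_algebra_bigcup. Qed.

(* The product sigma-algebra, generated by the coordinates; since R carries
   its Borel sigma-algebra, this is the Borel sigma-algebra of R^n. *)
HB.instance Definition _ := @isMeasurable.Build
  (measure_tuple_display default_measure_display) 'cV[R]_n
  (g_sigma_preimage coor) cV_set0 cV_setC cV_bigcup.

Lemma measurable_coor (i : 'I_n) :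
  measurable_fun [set: 'cV[R]_n] (fun x => x i ord0).
Proof.
move=> _ Y mY; rewrite setTI; apply: sub_sigma_algebra => /=.
rewrite -bigcup_seq/=; exists i => /=; first by rewrite mem_index_enum.
by exists Y => //; rewrite setTI.
Qed.

Lemma measurable_cVP d (T : measurableType d) (f : T -> 'cV[R]_n) :
  (forall i, measurable_fun [set: T] (fun t => f t i ord0)) ->
  measurable_fun [set: T] f.
Proof.
move=> mf.
suff H : g_sigma_preimage coor `<=` [set A | measurable (f @^-1` A)].
  by move=> _ A mA; rewrite setTI; exact: H.
apply: smallest_sub.
  split => /=.
  - by rewrite preimage_set0.
  - move=> A mA; rewrite setTD preimage_setC; exact: measurableC.
  - by move=> F mF; rewrite preimage_bigcup; exact: bigcup_measurable.
rewrite -bigcup_seq/= => A [i _ [B mB <-]] /=.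
by rewrite setTI -[X in measurable X]setTI; exact: mf.
Qed.

End measurable_cV.

Section lebesgue_cV.
Variable R : realType.

Definition cV_rcons n (p : 'cV[R]_n * measurableTypeR R) : 'cV[R]_n.+1 :=
  \col_(i < n.+1) if unlift ord_max i is Some j then p.1 j ord0 else p.2.

Lemma measurable_cV_rcons n : measurable_fun setT (@cV_rcons n).
Proof.
apply: measurable_cVP => i; rewrite /cV_rcons.
case: (unliftP ord_max i) => [j ->|->].
  under eq_fun do rewrite mxE liftK.
  exact: (measurableT_comp (@measurable_coor R n j) measurable_fst).
under eq_fun do rewrite mxE unlift_none.
exact: measurable_snd.
Qed.

Section lebesgue_cV_step.
Variables (n : nat) (mu : {measure set 'cV[R]_n -> \bar R}).

Definition lebesgue_cV_step :=
  pushforward (mu \x @lebesgue_measure R)%E (@cV_rcons n).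

Let step0 : lebesgue_cV_step set0 = 0%E.
Proof. by rewrite /lebesgue_cV_step /pushforward preimage_set0 measure0. Qed.

Let step_ge0 A : (0 <= lebesgue_cV_step A)%E.
Proof. by rewrite /lebesgue_cV_step /pushforward measure_ge0. Qed.

Let step_sigma_additive : semi_sigma_additive lebesgue_cV_step.
Proof.
move=> F mF tF mUF; rewrite /lebesgue_cV_step /pushforward preimage_bigcup.
have mpre A : measurable A -> measurable (@cV_rcons n @^-1` A).
  by move=> mA; rewrite -[X in measurable X]setTI; exact: measurable_cV_rcons.
apply: measure_semi_sigma_additive => [i||]; first exact: mpre.
- apply/trivIsetP => /= i j _ _ ij; rewrite -preimage_setI.
  by move/trivIsetP : tF => /(_ _ _ _ _ ij) ->//; rewrite preimage_set0.
- by rewrite -preimage_bigcup; exact: mpre.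
Qed.

HB.instance Definition _ := isMeasure.Build _ _ _ lebesgue_cV_step
  step0 step_ge0 step_sigma_additive.

End lebesgue_cV_step.

(* Lebesgue measure on R^n as the n-fold product of lebesgue_measure. *)
Fixpoint lebesgue_cV n : {measure set 'cV[R]_n -> \bar R} :=
  match n with
  | 0 => \d_ (0 : 'cV[R]_0)
  | m.+1 => lebesgue_cV_step (lebesgue_cV m)
  end.

Lemma measurable_box n (A : 'I_n -> set R) :
  (forall i, measurable (A i)) ->
  measurable [set x : 'cV[R]_n | forall i, A i (x i ord0)].
Proof.
move=> mA.
rewrite (_ : [set _ | _] =
    \big[setI/setT]_(i < n) ((fun x : 'cV[R]_n => x i ord0) @^-1` A i)).
  apply: bigsetI_measurable => i _; rewrite -[X in measurable X]setTI.
  exact: measurable_coor.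
rewrite -bigcap_seq; apply/seteqP; split => x /= h i; first by move=> _; exact: h.
by apply: h => /=; rewrite mem_index_enum.
Qed.

Lemma lebesgue_cV_box n (A : 'I_n -> set R) :
  (forall i, measurable (A i)) ->
  lebesgue_cV n [set x | forall i, A i (x i ord0)] =
  (\prod_(i < n) lebesgue_measure (A i : set (measurableTypeR R)))%E.
Proof.
elim: n A => [|n ih] A mA /=.
  by rewrite big_ord0 diracE mem_set// => -[].
rewrite /lebesgue_cV_step /pushforward big_ord_recr/=.
rewrite -(ih (fun i => A (widen_ord (leqnSn n) i)))//.
have mB := measurable_box (fun i => mA (widen_ord (leqnSn n) i)).
rewrite -(product_measure1E (lebesgue_cV n)
  (@lebesgue_measure R : {sigma_finite_measure set _ -> \bar R})
  mB (mA ord_max)).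
congr (product_measure1 _ _ _); apply/seteqP; split => -[x y] /=; rewrite /cV_rcons /=.
  move=> h; split => [i|].
    have := h (lift ord_max i); rewrite mxE liftK/=.
    by congr (A _ _); apply/val_inj; rewrite /= /bump leqNgt ltn_ord.
  by have := h ord_max; rewrite mxE unlift_none.
move=> [hx hy] i; rewrite mxE; case: (unliftP ord_max i) => [j ->|->] //=.
have := hx j; congr (A _ _); apply/val_inj.
by rewrite /= /bump leqNgt ltn_ord.
Qed.

End lebesgue_cV.

(* Euclidean structure of R^d: the library norm on matrices is the sup norm. *)
Section euclidean.
Variables (R : realType) (d : nat).
Implicit Types (x y u v : 'cV[R]_d).

Definition cV_dot u v : R := \sum_(i < d) u i ord0 * v i ord0.

Definition cV_norm v : R := Num.sqrt (cV_dot v v).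

Definition cV_ball x (eps : R) : set 'cV[R]_d := [set y | cV_norm (y - x) < eps].

Definition unit_ball_volume : R := fine (lebesgue_cV R d (cV_ball 0 1)).

Definition frobenius (F : 'M[R]_d) : R := Num.sqrt (\sum_(i < d) \sum_(j < d) F i j ^+ 2).

Definition bounded_domain (Omega : set 'cV[R]_d) : Prop :=
  [/\ open Omega, connected Omega, bounded_set Omega & Omega !=set0].

End euclidean.

Section constitutive_data.
Variable R : realType.

Definition convex_on (D : set R) (f : R -> R) : Prop :=
  @convex_function R R^o D f.

Definition concave_on (D : set R) (f : R -> R) : Prop :=
  convex_on D (fun x => - f x).

(* J is only relevant on [0, +oo[; as J vanishes on [1, +oo[, "decreasing" is
   non-strict. *)
Record influence_function (J : R -> R) (M : R) : Prop := InfluenceFunction {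
  influence_ge0 : forall q, 0 <= q -> 0 <= J q ;
  influence_nonincreasing : {in `[0, +oo[ &, nonincreasing_fun J} ;
  influence_gt0 : {in `[0, 1[, forall q, 0 < J q} ;
  influence_at0 : J 0 = M ;
  influence_eq0 : forall q, 1 <= q -> J q = 0 }.

(* The bond potential g(r) = f(r^2).  The threshold at which g becomes constant
   is r = rplus, that is argument rplus^2 for f. *)
Record bond_potential (f g : R -> R) (rc rplus ginf : R) : Prop := BondPotential {
  potentialE : forall r, g r = f (r ^+ 2) ;
  profile0 : f 0 = 0 ;
  profile_increasing : {in `[0, rplus ^+ 2] &, increasing_fun f} ;
  profile_concave : concave_on `[0, rplus ^+ 2] f ;
  potential_derivable : forall r, derivable g r 1 ;
  potential_derivable2 : forall r, derivable (g^`(1))%classic r 1 ;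
  potential_bounded : bounded_fun g ;
  potential_bounded1 : bounded_fun (g^`(1))%classic ;
  potential_bounded2 : bounded_fun (g^`(2))%classic ;
  potential_const : forall r, rplus <= r -> g r = ginf ;
  potential_C4 : \forall r \near (0 : R),
    (forall k, (k < 4)%N -> derivable (g^`(k))%classic r 1) /\
    {for r, continuous (g^`(4))%classic} ;
  potential_odd1 : (g^`(1))%classic 0 = 0 ;
  potential_odd3 : (g^`(3))%classic 0 = 0 ;
  rc_gt0 : 0 < rc ;
  rc_lt_rplus : rc < rplus ;
  (* rc is the one point where g passes from convex to concave on r > 0 *)
  rc_inflection : forall c, 0 < c ->
    (convex_on `[0, c] g /\ concave_on `[c, +oo[ g) <-> c = rc }.

End constitutive_data.

Section model.
Variables (R : realType) (d : nat).
Implicit Types (x y : 'cV[R]_d) (u : R -> 'cV[R]_d -> 'cV[R]_d).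

Definition nonlocal_kernel (Omega : set 'cV[R]_d) (J : R -> R) (eps : R) y x : R :=
  \1_Omega y * J (cV_norm (y - x) / eps) /
  (eps * (unit_ball_volume R d * eps ^+ d)).

Definition bond_direction y x : 'cV[R]_d := (cV_norm (y - x))^-1 *: (y - x).

Definition strain u (t : R) y x : R :=
  cV_dot ((cV_norm (y - x))^-1 *: (u t y - u t x)) (bond_direction y x).

Definition scaled_strain u (t : R) y x : R :=
  Num.sqrt (cV_norm (y - x)) * strain u t y x.

Definition critical_strain (rc : R) y x : R := rc / Num.sqrt (cV_norm (y - x)).

Definition energy_density (Omega : set 'cV[R]_d) (J g : R -> R) (eps : R)
    (gamma : (R -> 'cV[R]_d -> 'cV[R]_d) -> 'cV[R]_d -> 'cV[R]_d -> R -> R)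
    (t : R) x u : \bar R :=
  (\int[lebesgue_cV R d]_(y in Omega)
    (nonlocal_kernel Omega J eps y x * gamma u y x t *
     g (scaled_strain u t y x))%:E)%E.

(* Junk value 0 unless d = 2 or d = 3. *)
Definition lame_mu (J g : R -> R) : R :=
  match d with
  | 2 => 8^-1 * (g^`(2))%classic 0 *
         \int[@lebesgue_measure R]_(q in `[0, 1]) (q ^+ 2 * J q)
  | 3 => 10^-1 * (g^`(2))%classic 0 *
         \int[@lebesgue_measure R]_(q in `[0, 1]) (q ^+ 3 * J q)
  | _ => 0
  end.

Definition lame_lambda (J g : R -> R) : R := lame_mu J g.

End model.

(* Main.v *)
(* Write e for the direction of y - x and r = sqrt|y - x| (F e . e).  Since g' and
   g''' vanish at 0 and g is bounded, |g(r) - g''(0)/2 r^2| <= C r^4 for all r, so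
   with r^2 = |y - x| (F e . e)^2 and |F e . e| <= |F| the quartic remainder
   contributes at most C M eps |F|^4.  After the substitution y = x + eps z the
   quadratic part is an integral of J(|z|) |z| (F e . e)^2, where e = z/|z|.
   The weight (F e . e)^2 is homogeneous of degree 0, and for such a weight W and a
   radial h, the integral of h(|z|) W(z) is the average of W over the unit ball
   times omega_d d int_0^oo h(q) q^(d-1) dq.  Taking h(q) = q^4 e^(-q^2) for both
   W = (F e . e)^2 and W = 1 expresses the average of (F e . e)^2 as a quotient of
   Gaussian integrals of (F z . z)^2 and |z|^4, which factor into one-dimensional
   moments: the average is (2|F|^2 + (tr F)^2) / (d (d + 2)). *)
Require Import Defs.
From HB Require Import structures.
From mathcomp Require Import all_boot all_order all_algebra.
From mathcomp Require Import all_classical all_reals all_analysis.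
From mathcomp Require Import measurable_realfun.
From mathcomp Require Import ring lra.

Set Implicit Arguments.
Unset Strict Implicit.
Unset Printing Implicit Defensive.
Import Order.TTheory GRing.Theory Num.Theory numFieldNormedType.Exports.

Local Open Scope classical_set_scope.
Local Open Scope ring_scope.

(** No surface measure on the sphere is used: the averaging identity compares two measures on the
    line, the distribution of |z| under W dz and the measure c n q^(n-1) dq on q >= 0, c being the
    integral of W over the unit ball. The radial function h does two things at once: its factor q^4
    clears the denominators of (F e . e)^2 and leaves a polynomial, and the Gaussian factor is
    radial as well as a product over coordinates. The number omega_d is never evaluated: it cancels
    against the normalisation of the kernel, and only its finiteness and positivity enter. The
    powers of eps come from y = x + eps z: the kernel leaves a factor 1/eps, r^2 carries eps and r^4
    carries eps^2, whence orders 1 and eps. *)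

Definition pushforward_measure d1 d2 (T1 : measurableType d1)
    (T2 : measurableType d2) (R : realType) (m : {measure set T1 -> \bar R})
    (f : T1 -> T2) (mf : measurable_fun setT f) : {measure set T2 -> \bar R} :=
  measure_function_pushforward__canonical__measure_function_Measure m mf.

(** * Affine change of variables on the line *)

Section affine1.
Variables (R : realType) (a r : R).
Hypothesis r0 : 0 < r.
Local Notation leb := (@lebesgue_measure R).

Let affine1 (t : measurableTypeR R) : measurableTypeR R := a + r * t.

Let measurable_affine1 : measurable_fun setT affine1.
Proof. by apply: measurable_funD => //; exact: measurable_funM. Qed.

Let scaled_push :=
  mscale (NngNum (ltW r0)) (pushforward_measure leb measurable_affine1).

(** Lebesgue measure is determined by its values on intervals []u, v]]; the preimage of such an
    interval has length (v - u) / r, which the factor r restores. *)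
Let lebesgue_measure_affine1 (A : set R) : measurable A -> leb A = scaled_push A.
Proof.
move=> mA; apply: (@lebesgue_measure_unique R scaled_push) => //.
move=> _ [[u v] _ <-] /=.
rewrite /scaled_push /mscale /= /pushforward.
have -> : affine1 @^-1` `]u, v]%classic = `](u - a) / r, (v - a) / r]%classic.
  apply/seteqP; split => t /=; rewrite /affine1 !in_itv /= => /andP[h1 h2];
    apply/andP; split.
  - by rewrite ltr_pdivrMr// ltrBlDl mulrC.
  - by rewrite ler_pdivlMr// lerBrDl mulrC.
  - by rewrite -ltrBlDl mulrC -ltr_pdivrMr.
  - by rewrite -lerBrDl mulrC -ler_pdivlMr.
rewrite !lebesgue_measure_itv/= !lte_fin ltr_pM2r ?invr_gt0// ltrD2r.
case: ifP => _; last by rewrite mule0.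
by rewrite -!EFinD -EFinM; congr EFin; field; rewrite gt_eqF.
Qed.

Lemma ge0_integral_affine1 (f : R -> \bar R) :
  measurable_fun setT f -> (forall t, (0 <= f t)%E) ->
  (\int[leb]_t f t = r%:E * \int[leb]_t f (a + r * t)%R)%E.
Proof.
move=> mf f0.
rewrite (@eq_measure_integral _ _ _ _ scaled_push); last first.
  by move=> A mA _; exact: lebesgue_measure_affine1.
by rewrite ge0_integral_mscale//= ge0_integral_pushforward.
Qed.

End affine1.

(** * Tonelli, Fubini, dilations and product integrands on R^n *)

Section lebesgue_cV_theory.
Variable R : realType.
Local Notation leb := (@lebesgue_measure R).
Local Open Scope ereal_scope.

Lemma lebesgue_cV_sigma_finite n : sigma_finite [set: 'cV[R]_n] (lebesgue_cV R n).
Proof.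
exists (fun k => [set x : 'cV[R]_n | forall i, `[(- k%:R)%R, k%:R]%classic (x i ord0)]).
  apply/esym/seteqP; split => // x _.
  pose m := \max_(i < n) (Num.truncn `|x i ord0|).+1.
  exists m => //= i; rewrite in_itv/= -ler_norml.
  rewrite (le_trans (ltW (truncnS_gt _)))//.
  by rewrite ler_nat (leq_bigmax (F := fun i => (Num.truncn `|x i ord0|).+1)).
move=> k; split.
  exact: (@measurable_box R n (fun=> `[(- k%:R)%R, k%:R]%classic)).
rewrite (@lebesgue_cV_box R n (fun=> `[(- k%:R)%R, k%:R]%classic))//.
suff: \prod_(i < n) leb `[(- k%:R)%R, k%:R]%classic \is a fin_num.
  by rewrite fin_numElt => /andP[].
apply: (big_ind (fun y => y \is a fin_num)) => //; first exact: fin_numM.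
by move=> i _; rewrite lebesgue_measure_itv; case: ifP => //= _; rewrite -EFinD.
Qed.

(* An alias to which sigma-finiteness can be attached: [lebesgue_cV] is a fixpoint
   that already returns a bundled measure. *)
Let lebesgue_fun n : set 'cV[R]_n -> \bar R := lebesgue_cV R n.

HB.instance Definition _ n := isMeasure.Build _ _ _ (@lebesgue_fun n)
  (measure0 (lebesgue_cV R n)) (measure_ge0 (lebesgue_cV R n))
  (@measure_semi_sigma_additive _ _ _ (lebesgue_cV R n)).

HB.instance Definition _ n := @Measure_isSigmaFinite.Build _ _ _ (@lebesgue_fun n)
  (@lebesgue_cV_sigma_finite n).

Lemma measurable_cV_tonelli n (f : 'cV[R]_n.+1 -> \bar R) :
  measurable_fun setT f -> (forall z, 0 <= f z) ->
  measurable_fun setT (fun p : 'cV[R]_n => \int[leb]_t f (cV_rcons (p, t))).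
Proof.
move=> mf f0.
apply: (@measurable_fun_fubini_tonelli_F _ _ _ _ _ leb (f \o @cV_rcons R n)).
  by apply: measurableT_comp => //; exact: measurable_cV_rcons.
by move=> z; exact: f0.
Qed.

Lemma lebesgue_cV_tonelli n (f : 'cV[R]_n.+1 -> \bar R) :
  measurable_fun setT f -> (forall z, 0 <= f z) ->
  \int[lebesgue_cV R n.+1]_z f z =
  \int[lebesgue_cV R n]_p \int[leb]_t f (cV_rcons (p, t)).
Proof.
move=> mf f0 /=.
rewrite ge0_integral_pushforward//=; last exact: measurable_cV_rcons.
rewrite preimage_setT.
rewrite (@fubini_tonelli1 _ _ _ _ _ (@lebesgue_fun n)
  leb (f \o @cV_rcons R n))//; last by move=> z; exact: f0.
by apply: measurableT_comp => //; exact: measurable_cV_rcons.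
Qed.

Lemma measurable_affine_cV n (a : 'cV[R]_n) (r : R) :
  measurable_fun setT (fun z : 'cV[R]_n => a + r *: z)%R.
Proof.
apply: measurable_cVP => i; under eq_fun do rewrite !mxE.
by apply: measurable_funD => //; apply: measurable_funM => //; exact: measurable_coor.
Qed.

(** A dilation acts on each coordinate separately, so every Tonelli step of the induction
    contributes one factor r. *)
Lemma ge0_integral_affine_cV n (a : 'cV[R]_n) (r : R) (f : 'cV[R]_n -> \bar R) :
  (0 < r)%R -> measurable_fun setT f -> (forall z, 0 <= f z) ->
  \int[lebesgue_cV R n]_z f z =
  (r ^+ n)%:E * \int[lebesgue_cV R n]_z f (a + r *: z)%R.
Proof.
move=> r0; elim: n => [|n ih] in a f *.
  move=> mf f0; rewrite expr0 mul1e; apply: eq_integral => z _.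
  by congr f; apply/matrixP => -[].
move=> mf f0.
have mf' : measurable_fun setT (fun z : 'cV[R]_n.+1 => f (a + r *: z)%R).
  by apply: measurableT_comp => //; exact: measurable_affine_cV.
rewrite lebesgue_cV_tonelli// (lebesgue_cV_tonelli mf')//.
(* [a1] is [a] without its last coordinate, which is handled by the one-dimensional change of
   variables. *)
pose a1 : 'cV[R]_n := (\col_i a (lift ord_max i) ord0)%R.
rewrite (ih a1); first last.
- by move=> p; exact: integral_ge0.
- exact: measurable_cV_tonelli.
have affine_step p : \int[leb]_t f (cV_rcons ((a1 + r *: p)%R, t)) =
    r%:E * \int[leb]_t f (a + r *: cV_rcons (p, t))%R.
  rewrite (@ge0_integral_affine1 R (a ord_max ord0) r r0
    (fun t => f (cV_rcons ((a1 + r *: p)%R, t))))//.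
    congr (_ * _); apply: eq_integral => t _; congr f.
    apply/matrixP => i j; rewrite /cV_rcons !mxE /=.
    by case: unliftP => [k ->|->]; rewrite ?mxE ?(ord1 j).
  apply: (measurableT_comp mf); apply: (measurableT_comp (@measurable_cV_rcons R n)).
  exact: pair1_measurable.
under eq_integral do rewrite affine_step.
rewrite ge0_integralZl//.
- by rewrite exprSr EFinM muleA.
- exact: (measurable_cV_tonelli mf').
- by move=> p _; exact: integral_ge0.
- by rewrite lee_fin ltW.
Qed.

Lemma lebesgue_cV_fubini n (f : 'cV[R]_n.+1 -> \bar R) :
  (lebesgue_cV R n.+1).-integrable setT f ->
  \int[lebesgue_cV R n.+1]_z f z =
  \int[lebesgue_cV R n]_p \int[leb]_t f (cV_rcons (p, t)).
Proof.
move=> /integrableP[mf foo].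
have mf' : measurable_fun setT (f \o @cV_rcons R n).
  by apply: measurableT_comp => //; exact: measurable_cV_rcons.
have intf : (@lebesgue_fun n \x leb).-integrable setT (f \o @cV_rcons R n).
  apply/integrableP; split => //; move: foo.
  rewrite /= ge0_integral_pushforward//=; first exact: measurable_cV_rcons.
  exact: measurableT_comp.
rewrite /= integral_pushforward//=; last exact: measurable_cV_rcons.
by rewrite preimage_setT -(integral12_prod_meas1 intf).
Qed.

(** Integrability and value are proved together: Fubini needs the integrability of the whole
    product, which is obtained from Tonelli and the integrability of the shorter product. *)
Lemma integral_cV_prod n (phi : 'I_n -> R -> R) (m : 'I_n -> R) :
  (forall i, leb.-integrable setT (EFin \o phi i)) ->
  (forall i, \int[leb]_t (phi i t)%:E = (m i)%:E) ->
  (lebesgue_cV R n).-integrable setT (fun z => (\prod_i phi i (z i ord0))%:E) /\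
  \int[lebesgue_cV R n]_z (\prod_i phi i (z i ord0))%:E = (\prod_i m i)%:E.
Proof.
elim: n phi m => [|n ih] phi m iphi phim.
  (* In dimension 0 the measure is a Dirac mass and the empty product is 1. *)
  split.
    under eq_fun do rewrite big_ord0.
    apply: finite_measure_integrable_cst => //=.
  under eq_integral do rewrite big_ord0.
  by rewrite integral_cst//= diracT mule1 big_ord0.
pose phi' i := phi (lift ord_max i).
have [ih1 ih2] := ih phi' (fun i => m (lift ord_max i)) (fun i => iphi _) (fun i => phim _).
have prodE p t : (\prod_i phi i (cV_rcons (p, t) i ord0) =
    \prod_i phi' i (p i ord0) * phi ord_max t)%R.
  rewrite big_ord_recr/=; congr (_ * _)%R; last by rewrite /cV_rcons mxE unlift_none.
  apply: eq_bigr => i _.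
  have -> : widen_ord (leqnSn n) i = lift ord_max i.
    by apply/val_inj; rewrite /= /bump leqNgt ltn_ord.
  by rewrite /cV_rcons mxE liftK.
have mphi i : measurable_fun setT (phi i).
  by have /integrableP[/measurable_EFinP] := iphi i.
have mprod : measurable_fun setT (fun z : 'cV[R]_n.+1 => (\prod_i phi i (z i ord0))%R).
  apply: measurable_prod => i _; apply: measurableT_comp => //; exact: measurable_coor.
have int1 : (lebesgue_cV R n.+1).-integrable setT (fun z => (\prod_i phi i (z i ord0))%:E).
  apply/integrableP; split; first exact/measurable_EFinP.
  rewrite lebesgue_cV_tonelli//; last first.
    by apply: measurableT_comp => //; exact/measurable_EFinP.
  have prod_abs p : \int[leb]_t `|(\prod_i phi i (cV_rcons (p, t) i ord0))%:E| =
      `|(\prod_i phi' i (p i ord0))%:E| * \int[leb]_t `|(phi ord_max t)%:E|.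
    rewrite -ge0_integralZl//; last first.
      by apply: measurableT_comp => //; apply/measurable_EFinP; exact: mphi.
    by apply: eq_integral => t _; rewrite prodE EFinM abseM.
  under eq_integral do rewrite prod_abs.
  have [mprod' fprod'] := integrableP _ _ _ ih1.
  have [_ fphi] := integrableP _ _ _ (iphi ord_max).
  rewrite /= ge0_integralZr//=.
  - by rewrite lte_mul_pinfty// ?integral_ge0// ge0_fin_numE// integral_ge0.
  - apply/measurable_EFinP; apply: measurableT_comp => //; exact/measurable_EFinP.
  - exact: integral_ge0.
split => //; rewrite lebesgue_cV_fubini//.
have prod_int p : \int[leb]_t (\prod_i phi i (cV_rcons (p, t) i ord0))%:E =
    (\prod_i phi' i (p i ord0))%:E * (m ord_max)%:E.
  rewrite -phim -integralZl//; last exact: iphi.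
  by apply: eq_integral => t _; rewrite prodE EFinM.
under eq_integral do rewrite prod_int.
by rewrite /= integralZr// ih2 big_ord_recr/= EFinM; congr (_%:E * _); apply: eq_bigr => i _;
  congr m; apply/val_inj; rewrite /= /bump leqNgt ltn_ord.
Qed.

End lebesgue_cV_theory.

(** * Integration against a measure given by a density *)

Section density.
Context d (T : measurableType d) (R : realType).
Variables (mu : {measure set T -> \bar R}) (w : T -> R).
Hypotheses (mw : measurable_fun setT w) (w0 : forall x, 0 <= w x).
Local Open Scope ereal_scope.

Definition density (A : set T) := \int[mu]_(x in A) (w x)%:E.

Let density0 : density set0 = 0. Proof. exact: integral_set0. Qed.

Let density_ge0 A : 0 <= density A.
Proof. by apply: integral_ge0 => x _; rewrite lee_fin. Qed.

Let density_sigma_additive : semi_sigma_additive density.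
Proof.
move=> F mF tF mUF; rewrite /density ge0_integral_bigcup//; last 2 first.
- by apply/measurable_EFinP; exact: measurable_funTS.
- by move=> x _; rewrite lee_fin.
by apply: is_cvg_ereal_nneg_natsum_cond => n _ _; exact: density_ge0.
Qed.

HB.instance Definition _ := isMeasure.Build _ _ _ density
  density0 density_ge0 density_sigma_additive.

Definition density_measure : {measure set T -> \bar R} := density.

Import HBNNSimple.

Let integral_density_nnsfun (f : {nnsfun T >-> R}) :
  \int[density_measure]_x (f x)%:E = \int[mu]_x ((f x)%:E * (w x)%:E).
Proof.
under [LHS]eq_integral do rewrite fimfunE -fsumEFin//.
rewrite [LHS]ge0_integral_fsum//; last 2 first.
  - by move=> r; exact/measurable_EFinP/measurableT_comp.
  - by move=> n x _; rewrite EFinM nnfun_muleindic_ge0.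
have term_ge0 r x : 0 <= (w x)%:E * (r * \1_(f @^-1` [set r]) x)%:E.
  by rewrite mule_ge0 ?lee_fin// -lee_fin EFinM nnfun_muleindic_ge0.
under [RHS]eq_integral.
  move=> x xD; rewrite muleC fimfunE -fsumEFin// ge0_mule_fsumr; last first.
    by move=> r; rewrite EFinM nnfun_muleindic_ge0.
  over.
rewrite [RHS]ge0_integral_fsum//; last first.
  move=> r; apply/measurable_EFinP; apply: measurable_funM => //.
  by do 2 apply/measurableT_comp => //.
apply: eq_fsbigr => r _; rewrite integralZl_indic_nnsfun// integral_indic// setIT.
(* A nonnegative simple function takes no negative value, so both terms vanish for r < 0; for r >= 0
   the factor can be pulled out of the integral. *)
have [r0|r0] := ltP r 0%R.
  rewrite preimage_nnfun0//= measure0 mule0 integral0_eq// => x _.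
  by rewrite indic0 mulr0 mule0.
under eq_integral do rewrite EFinM muleCA.
rewrite ge0_integralZl//; last 2 first.
  - by apply/measurable_EFinP; apply: measurable_funM.
  - by move=> x _; rewrite -EFinM lee_fin mulr_ge0.
congr (_ * _); rewrite /= /density integral_mkcond; apply: eq_integral => x _.
by rewrite patchE indicE; case: ifPn => _; rewrite ?mule1 ?mule0.
Qed.

(** Monotone convergence along simple approximations, applied on both sides. *)
Lemma ge0_integral_density (f : T -> \bar R) :
  measurable_fun setT f -> (forall x, 0 <= f x) ->
  \int[density_measure]_x f x = \int[mu]_x (f x * (w x)%:E).
Proof.
move=> mf f0; pose f_ := nnsfun_approx measurableT mf.
transitivity (limn (fun n => \int[density_measure]_x (f_ n x)%:E)).
  rewrite -monotone_convergence//.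
  - apply: eq_integral => x _; apply/esym/cvg_lim => //.
    by apply: cvg_nnsfun_approx.
  - by move=> n; exact/measurable_EFinP/measurable_funP.
  - by move=> n x _; rewrite lee_fin.
  - by move=> x _ m n mn; rewrite lee_fin; exact/lefP/nd_nnsfun_approx.
under eq_fun do rewrite integral_density_nnsfun.
rewrite -monotone_convergence//.
- apply: eq_integral => x _; apply/cvg_lim => //.
  by apply: cvgeZr => //; exact: cvg_nnsfun_approx.
- move=> n; apply: emeasurable_funM; exact/measurable_EFinP.
- by move=> n x _; rewrite mule_ge0// lee_fin.
- move=> x _ m n mn; rewrite lee_wpmul2r ?lee_fin//.
  exact/lefP/nd_nnsfun_approx.
Qed.

End density.

(** * The Euclidean norm and its measurability *)

Section euclidean_norm.
Variables (R : realType) (n : nat).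
Implicit Types (x z : 'cV[R]_n) (r : R).

Lemma cV_norm_ge0 z : 0 <= cV_norm z. Proof. exact: sqrtr_ge0. Qed.

Lemma cV_dot_ge0 z : 0 <= cV_dot z z.
Proof. by apply: sumr_ge0 => i _; rewrite -expr2 sqr_ge0. Qed.

Lemma cV_norm_sqr z : cV_norm z ^+ 2 = cV_dot z z.
Proof. by rewrite sqr_sqrtr// cV_dot_ge0. Qed.

Lemma cV_dotZ r s x z : cV_dot (r *: x) (s *: z) = r * s * cV_dot x z.
Proof.
by rewrite /cV_dot big_distrr; apply: eq_bigr => i _; rewrite !mxE mulrACA.
Qed.

Lemma cV_normZ r z : cV_norm (r *: z) = `|r| * cV_norm z.
Proof.
by rewrite /cV_norm cV_dotZ sqrtrM -?expr2 ?sqr_ge0// sqrtr_sqr.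
Qed.

Lemma cV_norm_eq0 z : (cV_norm z == 0) = (z == 0).
Proof.
apply/idP/idP => [|/eqP ->]; last first.
  by rewrite /cV_norm /cV_dot big1 ?sqrtr0// => i _; rewrite mxE mul0r.
rewrite sqrtr_eq0 => z0; apply/eqP/matrixP => i j; rewrite ord1 mxE.
have /psumr_eq0P : cV_dot z z = 0 by apply/eqP; rewrite eq_le z0 cV_dot_ge0.
have zi0 : forall i, true -> 0 <= z i ord0 * z i ord0 by move=> k _; rewrite -expr2 sqr_ge0.
by move=> /(_ zi0 i isT)/eqP; rewrite mulf_eq0 orbb => /eqP.
Qed.

Lemma coor_le_norm z i : `|z i ord0| <= cV_norm z.
Proof.
rewrite -sqrtr_sqr ler_sqrt ?cV_dot_ge0// /cV_dot (bigD1 i)//= expr2 lerDl.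
by apply: sumr_ge0 => j _; rewrite -expr2 sqr_ge0.
Qed.

Lemma measurable_cV_dot d (T : measurableType d) (f g : T -> 'cV[R]_n) :
  measurable_fun setT f -> measurable_fun setT g ->
  measurable_fun setT (fun t => cV_dot (f t) (g t)).
Proof.
move=> mf mg; apply: measurable_sum => i; apply: measurable_funM.
  exact: (measurableT_comp (@measurable_coor R n i)).
exact: (measurableT_comp (@measurable_coor R n i)).
Qed.

Lemma measurable_cV_norm : measurable_fun setT (@cV_norm R n).
Proof.
apply: (measurableT_comp (f := @Num.sqrt R)).
  exact: (continuous_measurable_fun (@sqrt_continuous R)).
exact: measurable_cV_dot.
Qed.

Lemma cV_ball01E : cV_ball 0 1 = [set z : 'cV[R]_n | cV_norm z < 1].
Proof. by apply/funext => z; rewrite /cV_ball/= subr0. Qed.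

Lemma measurable_cV_ball01 : measurable (cV_ball 0 1 : set 'cV[R]_n).
Proof.
rewrite cV_ball01E -[X in measurable X]setTI.
rewrite (_ : [set z | _] = @cV_norm R n @^-1` `]-oo, 1[); last first.
  by apply/seteqP; split => z; rewrite /= in_itv.
exact: measurable_cV_norm.
Qed.

End euclidean_norm.

(** * Polar coordinates for a weight homogeneous of degree 0 *)

Section polar.
Variables (R : realType) (n : nat).
Hypothesis n0 : (0 < n)%N.
Local Notation leb := (@lebesgue_measure R).
Variables (W : 'cV[R]_n -> R) (c : R).
Hypotheses (mW : measurable_fun setT W) (W0 : forall z, 0 <= W z).
Hypothesis WZ : forall r z, 0 < r -> W (r *: z) = W z.
Hypothesis Wc : (\int[lebesgue_cV R n]_(z in cV_ball 0 1) (W z)%:E = c%:E)%E.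
Local Open Scope ereal_scope.

Let c0 : (0 <= c)%R.
Proof. by rewrite -lee_fin -Wc; apply: integral_ge0 => z _; rewrite lee_fin. Qed.

(** The derivative of c max(q, 0)^n away from 0, that is, the density expected for the distribution
    of |z|. *)
Let v (q : R) : R := (c * n%:R * (q ^+ n.-1 * \1_`[0%R, +oo[ q))%R.

Let v0 q : (0 <= v q)%R.
Proof.
rewrite /v indicE; case: (boolP (_ \in _)) => [|_]; last by rewrite !mulr0.
rewrite inE/= in_itv/= andbT => q0.
by rewrite mulr1 !mulr_ge0// exprn_ge0.
Qed.

Let mv : measurable_fun setT v.
Proof.
apply: measurable_funM => //; apply: measurable_funM; first exact: exprn_measurable.
exact: measurable_indic.
Qed.

(** The distribution of |z| when R^n carries the measure W dz. *)
Let radial := pushforward_measure (T2 := measurableTypeR R)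
  (density_measure (lebesgue_cV R n) mW W0)
  (@measurable_cV_norm R n).

(* Scaling: by homogeneity of [W], the integral of [W] over the ball of radius r
   is r^n times its integral over the unit ball. *)
Let radialE r : radial `]-oo, r[%classic = (c * Num.max r 0 ^+ n)%:E.
Proof.
rewrite /radial /= /pushforward/= /density.
have [r0|r0] := leP r 0%R.
  rewrite (_ : _ @^-1` _ = set0) ?integral_set0 ?expr0n -?lt0n ?n0 ?mulr0//.
    by rewrite gtn_eqF// mulr0.
  apply/seteqP; split => z //=; rewrite in_itv/= => zr.
  by have := cV_norm_ge0 z; rewrite leNgt (lt_le_trans zr).
rewrite integral_mkcond (@ge0_integral_affine_cV R n 0%R r)//; last 2 first.
- apply/(measurable_restrictT _ _).1; last exact/measurable_EFinP/measurable_funTS.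
  by rewrite -[X in measurable X]setTI; exact: measurable_cV_norm.
- by move=> z; rewrite patchE; case: ifP => // _; rewrite lee_fin.
rewrite mulrC EFinM -Wc [in RHS]integral_mkcond; congr (_ * _).
apply: eq_integral => z _; rewrite add0r !patchE cV_ball01E WZ//.
congr (if _ then _ else _); apply/idP/idP; rewrite !inE/= in_itv/= cV_normZ gtr0_norm//.
  by rewrite gtr_pMr.
by rewrite gtr_pMr.
Qed.

Let mono := density_measure leb mv v0.

Let monoE r : mono `]-oo, r[%classic = (c * Num.max r 0 ^+ n)%:E.
Proof.
rewrite /mono /= /density.
have [r0|r0] := leP r 0%R.
  rewrite expr0n gtn_eqF// mulr0; apply: integral0_eq => q; rewrite /= in_itv/= => qr.
  rewrite /v indicE memNset ?mulr0//= in_itv/= andbT => q0.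
  by have := lt_le_trans qr (le_trans r0 q0); rewrite ltxx.
transitivity (\int[leb]_(q in `[0%R, r[) (c * (n%:R * q ^+ n.-1))%:E).
  rewrite [LHS]integral_mkcond [RHS]integral_mkcond; apply: eq_integral => q _.
  rewrite !patchE /v indicE.
  case: (ifPn (q \in `]-oo, r[%classic)); rewrite ?inE ?notin_setE/= !in_itv/=.
    move=> qr; case: ifPn; rewrite ?inE ?notin_setE/= in_itv/= qr andbT => q0.
      by rewrite mem_set ?mulr1 ?mulrA//= in_itv/= q0.
    by rewrite memNset ?mulr0//= in_itv/= andbT.
  move=> /negP; rewrite -leNgt => rq.
  by rewrite memNset//= in_itv/= ltNge rq andbF.
(* The fundamental theorem of calculus is applied on a closed interval, to the primitive c q^n; it
   vanishes at 0 because n > 0. *)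
rewrite integral_itv_bndo_bndc; last first.
  apply/measurable_EFinP; apply: measurable_funM => //; exact: measurable_funM.
rewrite (@continuous_FTC2 _ _ (fun q => c * q ^+ n)%R)//.
- by rewrite expr0n gtn_eqF// mulr0 sube0.
- apply: continuous_subspaceT => q; apply: cvgM; first exact: cvg_cst.
  apply: cvgM; first exact: cvg_cst.
  exact: exprn_continuous.
- split.
  + by move=> q _; apply: derivableM => //; exact: exprn_derivable.
  + apply: cvg_at_right_filter; apply: cvgM; first exact: cvg_cst.
    exact: exprn_continuous.
  + apply: cvg_at_left_filter; apply: cvgM; first exact: cvg_cst.
    exact: exprn_continuous.
- move=> q _; rewrite derive1E deriveM//=; last exact: exprn_derivable.
  by rewrite derive_cst scaler0 addr0 exp_derive scaler1.
Qed.

(** The open left rays are stable under intersection, generate the Borel sets and exhaust the line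
    with finite mass, so agreement on them suffices. *)
Lemma radial_measure_unique A : measurable A -> radial A = mono A.
Proof.
apply: (@measure_unique _ R (measurableTypeR R)
  (@RGenInftyO.G R)
  (fun k => `]-oo, k%:R[%classic) _ _ _ _ radial mono).
- exact: RGenInftyO.measurableE.
- move=> _ _ [x ->] [y ->]; exists (Num.min x y).
  apply/seteqP; split => q; rewrite /= !in_itv/= lt_min.
    by move=> [-> ->].
  by move/andP.
- by move=> k; exists k%:R.
- apply/seteqP; split => // q _; exists (Num.truncn `|q|).+1 => //=.
  by rewrite in_itv/= (le_lt_trans (ler_norm _))// truncnS_gt.
- by move=> _ [x ->]; rewrite radialE monoE.
- by move=> k; rewrite radialE ltry.
Qed.

Lemma ge0_integral_polar (h : R -> R) :
  measurable_fun setT h -> (forall q, 0 <= h q)%R ->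
  \int[lebesgue_cV R n]_z (h (cV_norm z) * W z)%:E =
  (c * n%:R)%:E * \int[leb]_(q in `[0%R, +oo[) (h q * q ^+ n.-1)%:E.
Proof.
move=> mh h0.
transitivity (\int[radial]_q (h q)%:E).
  transitivity (\int[density_measure (lebesgue_cV R n) mW W0]_z (h (cV_norm z))%:E).
    rewrite ge0_integral_density//.
      apply/measurable_EFinP; apply: measurableT_comp => //.
      exact: measurable_cV_norm.
    by move=> z; rewrite lee_fin.
  apply/esym/(@ge0_integral_pushforward _ _ _ (measurableTypeR R) R (@cV_norm R n)
    (@measurable_cV_norm R n) _ setT (EFin \o h)) => //.
  - exact/measurable_EFinP.
  - by move=> q _; rewrite lee_fin.
rewrite (@eq_measure_integral _ _ _ _ mono); last first.
  by move=> A mA _; exact: radial_measure_unique.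
rewrite ge0_integral_density//; last exact/measurable_EFinP.
rewrite -ge0_integralZl//; last 3 first.
- apply/measurable_EFinP; apply: measurable_funM; apply: measurable_funTS => //.
- by move=> q; rewrite /= in_itv/= andbT => q0; rewrite lee_fin mulr_ge0// exprn_ge0.
- by rewrite lee_fin mulr_ge0.
rewrite [RHS]integral_mkcond; apply: eq_integral => q _.
rewrite patchE /v indicE; case: ifP => _; last by rewrite !mulr0 mule0.
by rewrite -!EFinM; congr EFin; rewrite mulr1; ring.
Qed.

End polar.

(** * Moments of the one-dimensional Gaussian *)

Section gauss_moments.
Variable R : realType.
Local Notation leb := (@lebesgue_measure R).

Definition gauss_monomial k (t : R) := t ^+ k * gauss_fun t.

Lemma continuous_gauss_monomial k : continuous (gauss_monomial k).
Proof.
move=> t; apply: cvgM; first exact: exprn_continuous.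
exact: continuous_gauss_fun.
Qed.

Lemma measurable_gauss_monomial k : measurable_fun setT (gauss_monomial k).
Proof. exact: continuous_measurable_fun (@continuous_gauss_monomial k). Qed.

Lemma gauss_monomial_ge0 k t : 0 <= t -> 0 <= gauss_monomial k t.
Proof. by move=> t0; rewrite mulr_ge0 ?exprn_ge0 ?gauss_fun_ge0. Qed.

Lemma is_derive_gauss_monomial k (t : R) :
  is_derive t 1 (gauss_monomial k.+1)
    (k.+1%:R * gauss_monomial k t - 2 * gauss_monomial k.+2 t).
Proof.
have dg : is_derive t 1 (fun x : R => expR (- x ^+ 2)) (expR (- t ^+ 2) * (- (2 * t))).
  apply: is_derive1_comp; apply: is_derive_eq.
  by rewrite /GRing.scale/=; ring.
have df : is_derive t 1 (fun x : R => x ^+ k.+1) (k.+1%:R * t ^+ k).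
  apply: DeriveDef; first exact: exprn_derivable.
  by rewrite exp_derive /GRing.scale/= mulr1.
have [dm dE] := is_deriveM df dg.
apply: DeriveDef; first exact: dm.
rewrite [LHS]dE /gauss_monomial /gauss_fun /GRing.scale/= !exprS; ring.
Qed.

(** One term of the exponential series gives e^(t^2) >= t^(2k+2) / (k+1)!; hence t^k e^(-t^2) < e as
    soon as t >= 1 and t > (k+1)! / e, where e is the tolerance. *)
Lemma cvgy_gauss_monomial k : gauss_monomial k t @[t --> +oo] --> (0 : R).
Proof.
apply/cvgr0Pnorm_le => e e0; near=> t.
have t1 : 1 <= t by near: t; apply: nbhs_pinfty_ge; rewrite num_real.
have t0 : 0 < t by rewrite (lt_le_trans ltr01).
have te : k.+1`!%:R / e < t.
  by near: t; apply: nbhs_pinfty_gt; rewrite num_real.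
rewrite ger0_norm ?gauss_monomial_ge0 ?ltW// /gauss_monomial /gauss_fun expRN.
rewrite ltr_pdivrMr ?expR_gt0//.
have := @expR_ge1Dxn R (t ^+ 2) k (sqr_ge0 _).
rewrite -exprM => expt.
have {}expt : t ^+ (2 * k.+1) / k.+1`!%:R <= expR (t ^+ 2).
  by apply: le_trans expt; rewrite lerDr.
have kf : 0 < k.+1`!%:R :> R by rewrite ltr0n fact_gt0.
apply: (@lt_le_trans _ _ (e * (t ^+ (2 * k.+1) / k.+1`!%:R))); last by rewrite ler_pM2l.
rewrite mulrA ltr_pdivlMr//.
have -> : e * t ^+ (2 * k.+1) = t ^+ k * (e * t) * t ^+ k.+1.
  by rewrite mul2n -addnn exprD exprS; ring.
rewrite -mulrA ltr_pM2l ?exprn_gt0//.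
apply: (@lt_le_trans _ _ (e * t)); last first.
  by rewrite ler_peMr ?exprn_ege1// mulr_ge0// ltW.
by rewrite mulrC -ltr_pdivrMr.
Unshelve. all: end_near. Qed.

Local Open Scope ereal_scope.

(** An extended real: the integrand is nonnegative, so the recursion can be stated before finiteness
    is known. *)
Let half k := \int[leb]_(t in `[0%R, +oo[) (gauss_monomial k t)%:E.

Let mEgauss (D : set R) c k : measurable D ->
  measurable_fun D (fun t => (c * gauss_monomial k t)%:E).
Proof.
move=> mD; apply/measurable_EFinP; apply: measurable_funTS.
by apply: measurable_funM => //; exact: measurable_gauss_monomial.
Qed.

Let dF k (t : R) := (k.+1%:R * gauss_monomial k t - 2 * gauss_monomial k.+2 t)%R.

Let continuous_dF k : continuous (dF k).
Proof.
move=> t; apply: cvgB; apply: cvgM; try exact: cvg_cst; exact: continuous_gauss_monomial.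
Qed.

Let derivable_gauss k t : derivable (gauss_monomial k.+1) t 1.
Proof. by have [] := is_derive_gauss_monomial k t. Qed.

Let derive_gauss k t : (gauss_monomial k.+1)^`()%classic t = dF k t.
Proof. by rewrite derive1E; have [_ ->] := is_derive_gauss_monomial k t. Qed.

(** On a compact interval all terms are integrable, so the sign of the derivative does not
    matter. *)
Let gauss_recur_bounded k a : (0 < a)%R ->
  \int[leb]_(t in `[0%R, a]) (k.+1%:R * gauss_monomial k t)%:E =
  \int[leb]_(t in `[0%R, a]) (2 * gauss_monomial k.+2 t)%:E + (gauss_monomial k.+1 a)%:E.
Proof.
move=> a0.
have ftc : \int[leb]_(t in `[0%R, a]) (dF k t)%:E = (gauss_monomial k.+1 a)%:E.
  rewrite (@continuous_FTC2 _ _ (gauss_monomial k.+1))//.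
  - by rewrite [X in _ - X%:E](_ : _ = 0%R) ?sube0// /gauss_monomial expr0n mul0r.
  - exact: continuous_subspaceT.
  - split => //.
    + by apply: cvg_at_right_filter; exact: continuous_gauss_monomial.
    + by apply: cvg_at_left_filter; exact: continuous_gauss_monomial.
have integ c j : leb.-integrable `[0%R, a] (fun t => (c * gauss_monomial j t)%:E).
  apply: continuous_compact_integrable; first exact: segment_compact.
  apply: continuous_subspaceT => t; apply: cvgM; first exact: cvg_cst.
  exact: continuous_gauss_monomial.
rewrite -ftc -integralD//=; last first.
  apply: continuous_compact_integrable; first exact: segment_compact.
  exact: continuous_subspaceT.
by apply: eq_integral => t _; rewrite -EFinD /dF; congr EFin; ring.
Qed.

(* Beyond k + 1 the derivative has constant sign, as required by the fundamental
   theorem of calculus on a half line. *)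
Let gauss_recur_tail k a : (k.+1%:R <= a)%R ->
  \int[leb]_(t in `[a, +oo[) (2 * gauss_monomial k.+2 t)%:E =
  \int[leb]_(t in `[a, +oo[) (k.+1%:R * gauss_monomial k t)%:E + (gauss_monomial k.+1 a)%:E.
Proof.
move=> ka.
have a1 : (1 <= a)%R by rewrite (le_trans _ ka)// ler1n.
have dF0 t : (a <= t)%R -> (0 <= - dF k t)%R.
  move=> at_; rewrite /dF /gauss_monomial opprB subr_ge0 (mulrA 2%R) (mulrA k.+1%:R).
  rewrite ler_wpM2r ?gauss_fun_ge0//.
  have t1 := le_trans a1 at_; have t0 := le_trans ler01 t1.
  rewrite !exprS (mulrA t) (mulrA 2%R) ler_wpM2r ?exprn_ge0//.
  (* What remains is k + 1 <= 2 t^2, true since t >= k + 1 and t >= 1. *)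
  by have := le_trans ka at_; nra.
have ftc : \int[leb]_(t in `[a, +oo[) (- dF k t)%:E = (gauss_monomial k.+1 a)%:E.
  rewrite (@ge0_continuous_FTC2y _ _ (\- (gauss_monomial k.+1))%R _ 0%R)//.
  - by rewrite sub0e -EFinN opprK.
  - by apply: continuous_subspaceT => t; apply: cvgN; exact: continuous_dF.
  - by rewrite -oppr0; apply: cvgN; exact: cvgy_gauss_monomial.
  - by move=> t _; exact: derivableN.
  - by apply: cvg_at_right_filter; apply: cvgN; exact: continuous_gauss_monomial.
  - by move=> t _; rewrite derive1E deriveN// -derive1E derive_gauss.
rewrite -ftc -ge0_integralD//=.
- by apply: eq_integral => t _; rewrite -EFinD /dF; congr EFin; ring.
- move=> t; rewrite in_itv/= andbT => at_; rewrite lee_fin mulr_ge0 ?gauss_monomial_ge0//.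
  exact: le_trans (le_trans ler01 a1) at_.
- exact: mEgauss.
- by move=> t; rewrite in_itv/= andbT => at_; rewrite lee_fin dF0.
- apply/measurable_EFinP; apply: measurable_funTS; apply: continuous_measurable_fun => t.
  by apply: cvgN; exact: continuous_dF.
Qed.

Let half_split k a c : (0 < a)%R -> (0 <= c)%R ->
  c%:E * half k = \int[leb]_(t in `[0%R, a]) (c * gauss_monomial k t)%:E +
             \int[leb]_(t in `[a, +oo[) (c * gauss_monomial k t)%:E.
Proof.
move=> a0 c0; rewrite /half -ge0_integralZl//; last 2 first.
- apply/measurable_EFinP; apply: measurable_funTS; exact: measurable_gauss_monomial.
- by move=> t; rewrite /= in_itv/= andbT => t0; rewrite lee_fin gauss_monomial_ge0.
(* Dropping the endpoint a from the tail makes the two pieces disjoint. *)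
rewrite -[in X in _ = _ + X]integral_itv_obnd_cbnd; last exact: mEgauss.
rewrite -ge0_integral_setU//=.
- rewrite -itv_bndbnd_setU// ?bnd_simp ?ltW//.
- apply/measurable_EFinP; apply: measurable_funTS; apply: measurable_funM => //.
  exact: measurable_gauss_monomial.
- move=> t; rewrite !in_itv/= andbT => tP; rewrite lee_fin mulr_ge0// gauss_monomial_ge0//.
  by case: tP => [/andP[]//|/ltW]; exact/le_trans/ltW.
- apply/eqP/seteqP; split => // t []; rewrite /= !in_itv/= andbT => /andP[_ ta].
  by rewrite ltNge ta.
Qed.

(** After splitting at a = k + 1, the boundary term at a is added once on each side. Nothing is
    subtracted, so possibly infinite values cause no trouble. *)
Lemma gauss_half_recur k : 2%:E * half k.+2 = k.+1%:R%:E * half k.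
Proof.
pose a : R := k.+1%:R; have a0 : (0 < a)%R by rewrite ltr0n.
rewrite !(half_split _ a0)// gauss_recur_tail// gauss_recur_bounded//.
by rewrite -addeA [(gauss_monomial _ _)%:E + _]addeC.
Qed.

(* The recursion is integration by parts: the derivative of t^(k+1) e^(-t^2) is
   (k+1) t^k e^(-t^2) - 2 t^(k+2) e^(-t^2). *)
Fixpoint gauss_moment k : R :=
  match k with
  | 0 => Num.sqrt pi
  | 1 => 0
  | j.+2 => j.+1%:R / 2 * gauss_moment j
  end.

Let mule2_inj (x : \bar R) (y : R) : 2%:E * x = y%:E -> x = (y / 2)%:E.
Proof.
by move=> xy; rewrite mulrC EFinM -xy muleA -EFinM mulVf// mul1e.
Qed.

Let symE k : ~~ odd k -> \int[leb]_t (gauss_monomial k t)%:E = 2%:E * half k.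
Proof.
move=> k_even; rewrite ge0_symfun_integralT.
- by rewrite -set_itvcy.
- by move=> t; rewrite mulr_ge0 ?gauss_fun_ge0 ?exprn_even_ge0.
- exact: continuous_gauss_monomial.
- move=> t; rewrite /= /gauss_monomial /gauss_fun sqrrN exprNn -signr_odd.
  by rewrite (negbTE k_even) mul1r.
Qed.

Let even_moment k : ~~ odd k -> \int[leb]_t (gauss_monomial k t)%:E = (gauss_moment k)%:E.
Proof.
suff IH j : ~~ odd j -> half j = (gauss_moment j / 2)%:E.
  by move=> ko; rewrite symE// IH// -EFinM; congr EFin; field.
elim/ltn_ind: j => -[_ _|[//|j] IH jo]; apply: mule2_inj.
  rewrite -symE// /= -integralT_gauss; apply: eq_integral => t _.
  by rewrite /gauss_monomial expr0 mul1r.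
rewrite gauss_half_recur IH// -?EFinM; last by rewrite /= negbK in jo.
by congr EFin; rewrite /=; field.
Qed.

Let even_integrable k : ~~ odd k -> leb.-integrable setT (EFin \o gauss_monomial k).
Proof.
move=> ko; apply/integrableP; split.
  by apply/measurable_EFinP; exact: measurable_gauss_monomial.
under eq_integral => t _ do rewrite /= ger0_norm ?mulr_ge0 ?gauss_fun_ge0 ?exprn_even_ge0//.
by rewrite even_moment// ltry.
Qed.

(** Even powers are nonnegative with finite integral. An odd power is dominated by its two even
    neighbours, because |t| <= 1 + t^2. *)
Lemma integrable_gauss_monomial k : leb.-integrable setT (EFin \o gauss_monomial k).
Proof.
have [ko|] := boolP (odd k); last exact: even_integrable.
case: k => // k in ko *; have {}ko : ~~ odd k by [].
have k2 : ~~ odd k.+2 by rewrite /= negbK.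
apply: (@le_integrable _ _ _ leb setT measurableT (EFin \o gauss_monomial k.+1)
  ((EFin \o gauss_monomial k) \+ (EFin \o gauss_monomial k.+2))) => //.
- by apply/measurable_EFinP; exact: measurable_gauss_monomial.
- move=> t _ /=; rewrite lee_fin /gauss_monomial -mulrDl !normrM ler_wpM2r//.
  rewrite !exprS mulrA -[X in (X + _)%R]mul1r -mulrDl !normrM ler_wpM2r//.
  rewrite -expr2 [X in (_ <= X)%R]ger0_norm ?addr_ge0 ?sqr_ge0//.
  rewrite -(real_normK (num_real t)).
  by have := normr_ge0 t; nra.
- by apply: integrableD => //; exact: even_integrable.
Qed.

Lemma integral_gauss_monomial k :
  \int[leb]_t (gauss_monomial k t)%:E = (gauss_moment k)%:E.
Proof.
have [ko|] := boolP (odd k); last exact: even_moment.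
have -> : gauss_moment k = 0%R.
  by elim/ltn_ind: k ko => -[|[|k]] //= IH; rewrite negbK => ko; rewrite IH ?mulr0.
have mN : measurable_fun setT (-%R : R -> measurableTypeR R) by exact: oppr_measurable.
have gaussN : (EFin \o gauss_monomial k) \o -%R = (fun t => - (gauss_monomial k t)%:E).
  apply/funext => t /=; congr EFin.
  by rewrite /gauss_monomial /gauss_fun sqrrN exprNn -signr_odd ko expr1 mulN1r mulNr.
have fin := integrable_fin_num measurableT (integrable_gauss_monomial k).
(* Reflection t -> -t preserves Lebesgue measure and negates an odd integrand; as the integral is
   finite, it is 0. *)
have E : \int[leb]_t (gauss_monomial k t)%:E = - \int[leb]_t (gauss_monomial k t)%:E.
  transitivity (\int[pushforward_measure leb mN]_t (gauss_monomial k t)%:E).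
    by apply: eq_measure_integral => A mA _; apply/esym/lebesgue_measureN.
  rewrite -integralN; last by apply: integrable_add_def => //; exact: integrable_gauss_monomial.
  rewrite -[X in _ = integral _ _ X]gaussN.
  apply: (@integral_pushforward _ _ (measurableTypeR R) (measurableTypeR R) R -%R mN leb
    setT (EFin \o gauss_monomial k)) => //.
    by apply/measurable_EFinP; exact: measurable_gauss_monomial.
  by rewrite preimage_setT gaussN; apply: integrableN => //; exact: integrable_gauss_monomial.
move: E; move: fin => /fineK <-; rewrite -EFinN => -[E]; congr EFin; lra.
Qed.

End gauss_moments.

(** * The quadratic form F z . z and its homogeneous version *)

Section quadratic_form.
Variables (R : realType) (n : nat).
Implicit Types (z : 'cV[R]_n) (F : 'M[R]_n).

(** A single sum over index pairs suits both Cauchy-Schwarz and the expansion of the square. *)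
Lemma quadratic_formE F z :
  cV_dot (F *m z) z = \sum_(p : 'I_n * 'I_n) F p.1 p.2 * (z p.1 ord0 * z p.2 ord0).
Proof.
rewrite -(pair_bigA _ (fun i j => F i j * (z i ord0 * z j ord0))) /cV_dot /=.
apply: eq_bigr => i _; rewrite mxE big_distrl; apply: eq_bigr => j _ /=.
by rewrite -mulrA [z j _ * _]mulrC.
Qed.

(** Lagrange's identity: twice the gap is the sum of the squares (a_i b_j - a_j b_i)^2. *)
Lemma sum_cauchy_schwarz (I : finType) (a b : I -> R) :
  (\sum_i a i * b i) ^+ 2 <= (\sum_i a i ^+ 2) * (\sum_i b i ^+ 2).
Proof.
rewrite -subr_ge0 -(@pmulr_rge0 _ 2)//.
have -> : 2 * ((\sum_i a i ^+ 2) * (\sum_i b i ^+ 2) - (\sum_i a i * b i) ^+ 2) =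
    \sum_i \sum_j (a i * b j - a j * b i) ^+ 2.
  have E1 : \sum_i \sum_j a i ^+ 2 * b j ^+ 2 = (\sum_i a i ^+ 2) * (\sum_i b i ^+ 2).
    by rewrite big_distrlr.
  have E2 : \sum_i \sum_j a j ^+ 2 * b i ^+ 2 = (\sum_i a i ^+ 2) * (\sum_i b i ^+ 2).
    by rewrite exchange_big E1.
  have E3 : \sum_i \sum_j (a i * b i) * (a j * b j) = (\sum_i a i * b i) ^+ 2.
    by rewrite expr2 big_distrlr.
  rewrite mulrBr mulr2n mulrDl !mul1r -{1}E1 -E2 -E3 mulrDl !mul1r opprD.
  rewrite -!big_split -!sumrN -!big_split; apply: eq_bigr => i _ /=.
  rewrite -!sumrN -!big_split; apply: eq_bigr => j _ /=; ring.
by apply: sumr_ge0 => i _; apply: sumr_ge0 => j _; exact: sqr_ge0.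
Qed.

Lemma frobenius_sqr F : frobenius F ^+ 2 = \sum_(p : 'I_n * 'I_n) F p.1 p.2 ^+ 2.
Proof.
rewrite /frobenius sqr_sqrtr; first by rewrite pair_bigA.
by apply: sumr_ge0 => i _; apply: sumr_ge0 => j _; exact: sqr_ge0.
Qed.

Lemma quadratic_form_le F z :
  cV_dot (F *m z) z ^+ 2 <= (frobenius F * cV_norm z ^+ 2) ^+ 2.
Proof.
rewrite exprMn frobenius_sqr quadratic_formE.
apply: le_trans (sum_cauchy_schwarz _ _) _.
rewrite ler_wpM2l ?sumr_ge0// => [p _|]; first exact: sqr_ge0.
rewrite cV_norm_sqr /cV_dot expr2 big_distrlr /= pair_bigA /=.
by apply: ler_sum => p _; rewrite -!expr2 exprMn.
Qed.

(** Since the inverse of 0 is 0, the direction of the zero vector is 0; its norm is then at most 1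
    everywhere, with no exception at the origin. *)
Definition direction z : 'cV[R]_n := (cV_norm z)^-1 *: z.

Lemma directionZ r z : 0 < r -> direction (r *: z) = direction z.
Proof.
move=> r0; rewrite /direction cV_normZ gtr0_norm// scalerA invfM mulrAC.
by rewrite mulVf ?mul1r// gt_eqF.
Qed.

Lemma direction0 : direction 0 = 0. Proof. by rewrite /direction scaler0. Qed.

Lemma cV_norm_direction z : cV_norm (direction z) <= 1.
Proof.
rewrite /direction cV_normZ ger0_norm ?invr_ge0 ?cV_norm_ge0//.
have [->|z0] := eqVneq (cV_norm z) 0; first by rewrite mulr0.
by rewrite mulVf.
Qed.

Lemma normZ_direction z : z = cV_norm z *: direction z.
Proof.
have [->|z0] := eqVneq z 0; first by rewrite direction0 scaler0.
by rewrite /direction scalerA divff ?scale1r// cV_norm_eq0.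
Qed.

Definition strain_sqr F z := cV_dot (F *m direction z) (direction z) ^+ 2.

Lemma strain_sqrZ F r z : 0 < r -> strain_sqr F (r *: z) = strain_sqr F z.
Proof. by move=> r0; rewrite /strain_sqr directionZ. Qed.

Lemma strain_sqr_ge0 F z : 0 <= strain_sqr F z.
Proof. exact: sqr_ge0. Qed.

Lemma strain_sqr_le F z : strain_sqr F z <= frobenius F ^+ 2.
Proof.
apply: le_trans (quadratic_form_le _ _) _.
have F0 : 0 <= frobenius F by exact: sqrtr_ge0.
rewrite ler_pXn2r ?nnegrE ?mulr_ge0 ?exprn_ge0 ?cV_norm_ge0//.
by rewrite ler_piMr// expr_le1 ?cV_norm_ge0// cV_norm_direction.
Qed.

(** This turns the weight, singular at the origin, into a polynomial whose Gaussian moments are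
    computable. *)
Lemma normX4_strain_sqr F z :
  cV_norm z ^+ 4 * strain_sqr F z = cV_dot (F *m z) z ^+ 2.
Proof.
rewrite {3 4}(normZ_direction z) -scalemxAr cV_dotZ /strain_sqr; ring.
Qed.

Lemma measurable_direction : measurable_fun setT direction.
Proof.
apply: measurable_cVP => i; under eq_fun do rewrite mxE.
apply: measurable_funM; last exact: measurable_coor.
(* Measurability of the inverse is read off from the power with exponent -1, equal to it on
   nonnegative reals. *)
have -> : (fun z => (@cV_norm R n z)^-1) = (@powR R)^~ (-1) \o @cV_norm R n.
  by apply/funext => z /=; rewrite powR_inv1// cV_norm_ge0.
apply: measurableT_comp; last exact: measurable_cV_norm.
exact: measurable_powR.
Qed.

Lemma measurable_mulmx F : measurable_fun setT (fun z : 'cV[R]_n => F *m z).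
Proof.
apply: measurable_cVP => i; under eq_fun do rewrite mxE.
apply: measurable_sum => j; apply: measurable_funM => //; exact: measurable_coor.
Qed.

Lemma measurable_strain_sqr F : measurable_fun setT (strain_sqr F).
Proof.
apply: measurable_funX; apply: measurable_cV_dot; last exact: measurable_direction.
by apply: (measurableT_comp (@measurable_mulmx F)); exact: measurable_direction.
Qed.

End quadratic_form.

(** * Fourth-order Gaussian moments in R^n *)

Section gauss_quartic.
Variables (R : realType) (n : nat).
Implicit Types (z : 'cV[R]_n) (F : 'M[R]_n).

Definition gauss_cV z : R := \prod_i gauss_fun (z i ord0).

Lemma gauss_cVE z : gauss_cV z = gauss_fun (cV_norm z).
Proof.
rewrite /gauss_fun cV_norm_sqr /cV_dot -sumrN expR_sum.
by apply: eq_bigr => i _; rewrite /gauss_fun expr2.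
Qed.

(** The exponent of z_m in the monomial with indices [p.1], [p.2], [q.1], [q.2]. *)
Definition multiplicity (p q : 'I_n * 'I_n) (m : 'I_n) : nat :=
  ((m == p.1) + (m == p.2) + (m == q.1) + (m == q.2))%N.

Lemma prod_gauss_monomial p q z :
  \prod_m gauss_monomial (multiplicity p q m) (z m ord0) =
  (z p.1 ord0 * z p.2 ord0) * (z q.1 ord0 * z q.2 ord0) * gauss_cV z.
Proof.
have pick (i : 'I_n) : \prod_m z m ord0 ^+ (m == i) = z i ord0.
  rewrite (bigD1 i)//= eqxx expr1 big1 ?mulr1// => m /negbTE ->.
  by rewrite expr0.
rewrite /gauss_cV -(pick p.1) -(pick p.2) -(pick q.1) -(pick q.2) -!big_split.
by apply: eq_bigr => m _; rewrite /gauss_monomial /multiplicity !exprD /= !mulrA.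
Qed.

Definition gauss_moment4 (p q : 'I_n * 'I_n) : R :=
  \prod_m gauss_moment R (multiplicity p q m).

Lemma integral_gauss_quadratic_form F :
  (\int[lebesgue_cV R n]_z (cV_dot (F *m z) z ^+ 2 * gauss_cV z)%:E =
  (\sum_p \sum_q F p.1 p.2 * F q.1 q.2 * gauss_moment4 p q)%:E)%E.
Proof.
pose term (p q : 'I_n * 'I_n) z : R := F p.1 p.2 * F q.1 q.2 *
  \prod_m gauss_monomial (multiplicity p q m) (z m ord0).
have termE z : cV_dot (F *m z) z ^+ 2 * gauss_cV z = \sum_p \sum_q term p q z.
  rewrite quadratic_formE expr2 big_distrlr big_distrl; apply: eq_bigr => p _.
  rewrite /= big_distrl; apply: eq_bigr => q _ /=.
  by rewrite /term prod_gauss_monomial; ring.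
have moment p q := @integral_cV_prod R n
  (fun m => gauss_monomial (multiplicity p q m)) _
  (fun m => integrable_gauss_monomial R (multiplicity p q m))
  (fun m => integral_gauss_monomial R (multiplicity p q m)).
have iterm p q : (lebesgue_cV R n).-integrable setT (fun z => (term p q z)%:E).
  under eq_fun do rewrite /term EFinM.
  by apply: integrableZl => //; exact: (moment p q).1.
under eq_integral do rewrite termE -sumEFin.
rewrite integral_sum//; last first.
  move=> p; under eq_fun do rewrite -sumEFin.
  exact: integrable_sum.
rewrite -sumEFin; apply: eq_bigr => p _.
under eq_integral do rewrite -sumEFin.
rewrite integral_sum// -sumEFin; apply: eq_bigr => q _.
under eq_integral do rewrite /term EFinM.
by rewrite integralZl ?(moment p q).2 ?EFinM//; exact: (moment p q).1.
Qed.

(** Wick's formula: total mass pi^(n/2), covariance half the identity (hence 1/4), and one term for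
    each of the three pairings of four indices. It is checked on all index quadruples of dimensions
    2 and 3. *)
Lemma gauss_moment4E (p q : 'I_n * 'I_n) : n = 2%N \/ n = 3%N ->
  gauss_moment4 p q = Num.sqrt pi ^+ n / 4 *
    ((p.1 == p.2)%:R * (q.1 == q.2)%:R + (p.1 == q.1)%:R * (p.2 == q.2)%:R +
     (p.1 == q.2)%:R * (p.2 == q.1)%:R).
Proof.
rewrite /gauss_moment4 /multiplicity.
case: p q => [i j] [k l] /=.
case=> nE; move: i j k l; rewrite nE => i j k l; rewrite !big_ord_recl big_ord0.
  case: i j k l => [[|[|//]] ?] [[|[|//]] ?] [[|[|//]] ?] [[|[|//]] ?] /=; by field.
case: i j k l => [[|[|[|//]]] ?] [[|[|[|//]]] ?] [[|[|[|//]]] ?] [[|[|[|//]]] ?] /=; by field.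
Qed.

(** The three pairings contract to (tr F)^2, |F|^2 and the sum of F_ij F_ji; the last is |F|^2 by
    symmetry. *)
Lemma integral_gauss_strain F : n = 2%N \/ n = 3%N -> F^T = F ->
  (\int[lebesgue_cV R n]_z (cV_dot (F *m z) z ^+ 2 * gauss_cV z)%:E =
  (Num.sqrt pi ^+ n / 4 * (\tr F ^+ 2 + 2 * frobenius F ^+ 2))%:E)%E.
Proof.
move=> hn Fsym; rewrite integral_gauss_quadratic_form; congr EFin.
have trE : \tr F = \sum_(p : 'I_n * 'I_n) F p.1 p.2 * (p.1 == p.2)%:R.
  rewrite -(pair_bigA _ (fun i j => F i j * (i == j)%:R)) /mxtrace.
  apply: eq_bigr => i _; rewrite (bigD1 i)//= eqxx mulr1 big1 ?addr0// => j ji.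
  by rewrite eq_sym (negbTE ji) mulr0.
have E1 : \sum_p \sum_q F p.1 p.2 * F q.1 q.2 *
    ((p.1 == p.2)%:R * (q.1 == q.2)%:R) = \tr F ^+ 2.
  rewrite expr2 trE big_distrlr; apply: eq_bigr => p _; apply: eq_bigr => q _.
  by rewrite mulrACA.
have E2 : \sum_p \sum_q F p.1 p.2 * F q.1 q.2 *
    ((p.1 == q.1)%:R * (p.2 == q.2)%:R) = frobenius F ^+ 2.
  rewrite frobenius_sqr; apply: eq_bigr => p _.
  rewrite (bigD1 p)//= !eqxx !mulr1 big1 ?addr0 ?expr2// => q qp.
  rewrite -natrM mulnb -[_ && _]/(p == q) eq_sym (negbTE qp) mulr0//.
have E3 : \sum_p \sum_q F p.1 p.2 * F q.1 q.2 *
    ((p.1 == q.2)%:R * (p.2 == q.1)%:R) = frobenius F ^+ 2.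
  rewrite frobenius_sqr; apply: eq_bigr => -[i j] _.
  rewrite (bigD1 (j, i))//= !eqxx !mulr1 big1 ?addr0 => [|[k l] klji].
    by rewrite expr2 -[in F j i]Fsym mxE.
  by rewrite -natrM mulnb andbC -[_ && _]/((j, i) == (k, l)) eq_sym (negbTE klji) mulr0.
transitivity (Num.sqrt pi ^+ n / 4 *
  (\tr F ^+ 2 + frobenius F ^+ 2 + frobenius F ^+ 2)); last ring.
rewrite -{1}E1 -{1}E2 -E3 -!big_split big_distrr; apply: eq_bigr => p _.
rewrite /= -!big_split big_distrr; apply: eq_bigr => q _ /=.
by rewrite gauss_moment4E//; ring.
Qed.

End gauss_quartic.

(** * The mean of (F e . e)^2 over the unit ball *)

Section strain_average.
Variables (R : realType) (n : nat).
Local Notation leb := (@lebesgue_measure R).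
Local Notation B1 := (cV_ball 0 1 : set 'cV[R]_n).
Local Notation omega := (unit_ball_volume R n).
Implicit Types (F : 'M[R]_n).

(** The content is finiteness, so that [fine] loses nothing: the ball lies in the cube of side 2. *)
Lemma lebesgue_cV_ball01 : lebesgue_cV R n B1 = omega%:E.
Proof.
rewrite /unit_ball_volume fineK// ge0_fin_numE//.
pose A : 'I_n -> set R := fun=> `]-1, 1[%classic.
have mA i : measurable (A i) by exact: measurable_itv.
apply: (@le_lt_trans _ _ (lebesgue_cV R n [set x | forall i, A i (x i ord0)])).
  apply: le_measure; rewrite ?inE.
  - exact: measurable_cV_ball01.
  - exact: measurable_box.
  - move=> z; rewrite cV_ball01E/= => z1 i; rewrite /A/= in_itv/= -ltr_norml.
    exact: le_lt_trans (coor_le_norm z i) z1.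
rewrite lebesgue_cV_box//.
suff : (\prod_(i < n) leb (A i))%E \is a fin_num by rewrite fin_numElt => /andP[].
apply: (big_ind (fun y : \bar R => y \is a fin_num)) => //; first exact: fin_numM.
by move=> i _; rewrite lebesgue_measure_itv /=; case: ifP.
Qed.

Lemma unit_ball_volume_ge0 : 0 <= omega.
Proof. by rewrite fine_ge0. Qed.

Lemma integral_le_ball (W : 'cV[R]_n -> R) (c : R) : measurable_fun setT W ->
  (forall z, 0 <= W z <= c) ->
  (\int[lebesgue_cV R n]_(z in B1) (W z)%:E <= (c * omega)%:E)%E.
Proof.
move=> mW Wc; rewrite EFinM -lebesgue_cV_ball01 -integral_cst; last exact: measurable_cV_ball01.
apply: ge0_le_integral.
- exact: measurable_cV_ball01.
- by move=> z _; rewrite lee_fin; case/andP: (Wc z).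
- by apply/measurable_EFinP; exact: measurable_funTS.
- exact: measurable_cst.
- by move=> z _; rewrite lee_fin; case/andP: (Wc z).
Qed.

Hypothesis hn : n = 2%N \/ n = 3%N.

Let n0 : (0 < n)%N. Proof. by case: hn => ->. Qed.

Let quartic_gauss (q : R) := q ^+ 4 * gauss_fun q.

Let K := (\int[leb]_(q in `[0%R, +oo[) (quartic_gauss q * q ^+ n.-1)%:E)%E.

Let quartic_gauss_ge0 q : 0 <= quartic_gauss q.
Proof. by rewrite mulr_ge0 ?gauss_fun_ge0// exprn_even_ge0. Qed.

Let measurable_quartic_gauss : measurable_fun setT quartic_gauss.
Proof. exact: (@measurable_gauss_monomial R 4). Qed.

(* Polar coordinates for the weight 1, the integrand being read as the quadratic
   form of the identity matrix. *)
Let ball_polar : ((omega * n%:R)%:E * K =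
  (Num.sqrt pi ^+ n / 4 * (n%:R * (n%:R + 2)))%:E)%E.
Proof.
rewrite -(@ge0_integral_polar R n n0 (fun=> 1) omega)//; last first.
- by rewrite integral_cst ?mul1e ?lebesgue_cV_ball01//; exact: measurable_cV_ball01.
transitivity ((Num.sqrt pi ^+ n / 4 *
    (\tr (1%:M : 'M[R]_n) ^+ 2 + 2 * frobenius (1%:M : 'M[R]_n) ^+ 2))%:E); last first.
  congr (_%:E); congr (_ * _); rewrite mxtrace1 frobenius_sqr.
  rewrite -(pair_bigA _ (fun i j => (1%:M : 'M[R]_n) i j ^+ 2))/=.
  rewrite (eq_bigr (fun=> 1)); last first.
    move=> i _; rewrite (bigD1 i)//= mxE eqxx expr1n big1 ?addr0// => j ji.
    by rewrite mxE eq_sym (negbTE ji) expr0n.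
  by rewrite sumr_const card_ord; ring.
rewrite -(integral_gauss_strain hn (trmx1 _ _)); apply: eq_integral => z _; congr (_%:E).
by rewrite mulr1 gauss_cVE mul1mx -cV_norm_sqr /quartic_gauss -exprM.
Qed.

(** A null ball would make the left side of [ball_polar] vanish, while its right side is a positive
    Gaussian moment. *)
Lemma unit_ball_volume_gt0 : 0 < omega.
Proof.
rewrite lt0r unit_ball_volume_ge0 andbT; apply/eqP => omega0.
have := ball_polar; rewrite omega0 mul0r mul0e => -[] /esym/eqP.
rewrite !mulf_eq0 expf_eq0 sqrtr_eq0 leNgt pi_gt0/= andbF/= invr_eq0 !pnatr_eq0/=.
by rewrite -(natrD _ _ 2) pnatr_eq0 addn2 gtn_eqF.
Qed.

(** The radial integral [K] is the same as for the weight 1, so [ball_polar] eliminates it. *)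
Lemma integral_ball_strain_sqr F : F^T = F ->
  (\int[lebesgue_cV R n]_(z in B1) (strain_sqr F z)%:E =
  (omega / (n%:R * (n%:R + 2)) * (\tr F ^+ 2 + 2 * frobenius F ^+ 2))%:E)%E.
Proof.
move=> Fsym.
set I := (\int[_]_(z in _) _)%E.
have Ifin : I \is a fin_num.
  rewrite ge0_fin_numE; last by apply: integral_ge0 => z _; rewrite lee_fin strain_sqr_ge0.
  apply: (@le_lt_trans _ _ (frobenius F ^+ 2 * omega)%:E); last exact: ltry.
  apply: integral_le_ball; first exact: measurable_strain_sqr.
  by move=> z; rewrite strain_sqr_ge0 strain_sqr_le.
have [c IE] : exists c, I = c%:E by exists (fine I); rewrite fineK.
have := @ge0_integral_polar R n n0 (strain_sqr F) c (measurable_strain_sqr F)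
  (strain_sqr_ge0 F) (fun r z => @strain_sqrZ R n F r z) IE quartic_gauss
  measurable_quartic_gauss quartic_gauss_ge0.
have -> : (\int[lebesgue_cV R n]_z (quartic_gauss (cV_norm z) * strain_sqr F z)%:E)%E =
    (Num.sqrt pi ^+ n / 4 * (\tr F ^+ 2 + 2 * frobenius F ^+ 2))%:E.
  rewrite -integral_gauss_strain//; apply: eq_integral => z _; congr (_%:E).
  by rewrite gauss_cVE -normX4_strain_sqr /quartic_gauss; ring.
have KE : K = (Num.sqrt pi ^+ n / 4 * (n%:R + 2) / omega)%:E.
  have nN0 : (n%:R : R) != 0 by rewrite pnatr_eq0 -lt0n.
  have on0 : omega * n%:R != 0 by rewrite mulf_neq0// gt_eqF// unit_ball_volume_gt0.
  rewrite -[K]mul1e -(mulVf on0) EFinM -muleA ball_polar -EFinM; congr (_%:E).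
  by field; rewrite nN0 gt_eqF// unit_ball_volume_gt0.
rewrite -/K KE -EFinM IE => -[cE]; congr (_%:E).
have s0 : Num.sqrt pi ^+ n != 0 :> R by rewrite expf_neq0// gt_eqF// sqrtr_gt0 pi_gt0.
have nN0 : (n%:R : R) != 0 by rewrite pnatr_eq0 -lt0n.
have n2N0 : (n%:R + 2 : R) != 0 by rewrite -(natrD _ _ 2) pnatr_eq0 addn2.
have oN0 : omega != 0 by rewrite gt_eqF// unit_ball_volume_gt0.
apply: (@mulfI _ (Num.sqrt pi ^+ n / 4 * (n%:R * (n%:R + 2)) / omega)).
  by rewrite !mulf_neq0// invr_eq0.
transitivity (c * n%:R * (Num.sqrt pi ^+ n / 4 * (n%:R + 2) / omega)); first by field.
by rewrite -cE; field; rewrite nN0 oN0 n2N0.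
Qed.

Lemma ge0_integral_radial_strain (h : R -> R) F : F^T = F ->
  measurable_fun setT h -> (forall q, 0 <= h q) ->
  (\int[lebesgue_cV R n]_z (h (cV_norm z) * strain_sqr F z)%:E =
  (omega / (n%:R + 2) * (\tr F ^+ 2 + 2 * frobenius F ^+ 2))%:E *
  \int[leb]_(q in `[0%R, +oo[) (h q * q ^+ n.-1)%:E)%E.
Proof.
move=> Fsym mh h0.
rewrite (ge0_integral_polar n0 (measurable_strain_sqr F) (strain_sqr_ge0 F)
  (fun r z => @strain_sqrZ R n F r z) (integral_ball_strain_sqr Fsym) mh h0).
congr ((_)%:E * _)%E.
have nN0 : (n%:R : R) != 0 by rewrite pnatr_eq0 -lt0n.
have n2N0 : (n%:R + 2 : R) != 0 by rewrite -(natrD _ _ 2) pnatr_eq0 addn2.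
by field; rewrite nN0 n2N0.
Qed.

End strain_average.

(** * Quartic Taylor remainder of the potential *)

Section taylor.
Variable R : realType.
Implicit Types (phi dphi g : R -> R) (delta B x : R).

(** The mean value theorem between 0 and x. It keeps the same B instead of B / (k + 1), which makes
    the lemma easy to iterate. *)
Lemma le_antiderivative phi dphi delta B k :
  (forall x, `|x| < delta -> is_derive x (1 : R) phi (dphi x)) ->
  (forall x, `|x| < delta -> `|dphi x| <= B * `|x| ^+ k) ->
  phi 0 = 0 -> forall x, `|x| < delta -> `|phi x| <= B * `|x| ^+ k.+1.
Proof.
move=> dphiP dphiB phi0 x xd.
have d0 : 0 < delta by exact: le_lt_trans (normr_ge0 x) xd.
have B0 : 0 <= B * `|x| ^+ k by exact: le_trans (normr_ge0 _) (dphiB x xd).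
have [->|x0] := eqVneq x 0; first by rewrite phi0 !normr0 expr0n mulr0.
have mvt a b : a < b -> `|a| < delta -> `|b| < delta ->
    exists2 c, c \in `]a, b[%R & phi b - phi a = dphi c * (b - a).
  move=> ab; rewrite !ltr_norml => /andP[a1 a2] /andP[b1 b2].
  have inball c : c \in `[a, b]%R -> `|c| < delta.
    by rewrite in_itv/= ltr_norml => /andP[h1 h2]; lra.
  apply: MVT => //.
    by move=> c cab; apply: dphiP; apply: inball; exact: subset_itv_oo_cc.
  apply: derivable_within_continuous => c cab.
  by have [] := dphiP c (inball c cab).
have [c cx ->] : exists2 c, `|c| <= `|x| & phi x = dphi c * x.
  have [x_gt0|x_lt0|/esym/eqP] := ltgtP 0 x; last by rewrite (negbTE x0).
    have [|c] := mvt 0 x x_gt0 _ xd; first by rewrite normr0.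
    rewrite phi0 !subr0 in_itv/= => /andP[c0 cx] E; exists c => //.
    by rewrite !ger0_norm ?ltW.
  have [|c] := mvt x 0 x_lt0 xd; first by rewrite normr0.
  rewrite phi0 !sub0r in_itv/= => /andP[xc c0] E; exists c.
    by rewrite !ltr0_norm// lerN2 ltW.
  by apply: oppr_inj; rewrite E mulrN.
rewrite normrM exprSr mulrA ler_wpM2r//.
apply: le_trans (dphiB c (le_lt_trans cx xd)) _.
(* The sign of B is recovered from B |x|^k >= 0 and |x| > 0. *)
have x_gt0 : 0 < `|x| by rewrite normr_gt0.
rewrite ler_wpM2l ?lerXn2r ?nnegrE//.
by rewrite -(pmulr_lge0 _ (exprn_gt0 k x_gt0)).
Qed.

Lemma quartic_remainder g : bounded_fun g -> g 0 = 0 ->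
  (\forall r \near (0 : R),
    (forall k, (k < 4)%N -> derivable (g^`(k))%classic r 1) /\
    {for r, continuous (g^`(4))%classic}) ->
  (g^`(1))%classic 0 = 0 -> (g^`(3))%classic 0 = 0 ->
  exists2 C, 0 <= C & forall r,
    `|g r - (g^`(2))%classic 0 / 2 * r ^+ 2| <= C * r ^+ 4.
Proof.
move=> g_bnd g0 g_C4 g1 g3; set a := (g^`(2))%classic 0.
have [G G0 gG] : exists2 G, 0 <= G & forall r, `|g r| <= G.
  have [G0 [_ /(_ (`|G0| + 1))]] := g_bnd.
  rewrite (le_lt_trans (ler_norm _)) ?ltrDl// => /(_ isT) gG.
  by exists (`|G0| + 1) => [|r]; [rewrite addr_ge0|exact: gG].
(* The added 1 is the room in which continuity of the fourth derivative at 0 keeps it below B on a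
   neighbourhood. *)
pose B := `|(g^`(4))%classic 0| + 1.
have B0 : 0 <= B by rewrite addr_ge0.
have [delta /= d0 dP] : exists2 delta, 0 < delta & forall r, `|r| < delta ->
    (forall k, (k < 4)%N -> derivable (g^`(k))%classic r 1) /\
    `|(g^`(4))%classic r| <= B.
  have : \forall r \near (0 : R), (forall k, (k < 4)%N -> derivable (g^`(k))%classic r 1) /\
      `|(g^`(4))%classic r| <= B.
    have [_ cg4] := nbhs_singleton g_C4.
    have g4B : \forall r \near (0 : R), `|(g^`(4))%classic r| <= B.
      have cg4' : (g^`(4))%classic r @[r --> (0 : R)] --> (g^`(4))%classic (0 : R) by exact: cg4.
      by apply: (@cvgr_norm_le R R^o R _ _ _ _ cg4'); rewrite /B ltrDl.
    apply: filterI g4B.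
    by apply: filterS g_C4 => r [].
  move=> /nbhs_ballP[delta d0 dP]; exists delta => // r rd; apply: dP.
  by rewrite /ball/= sub0r normrN.
have dg k (r : R) : (k < 4)%N -> `|r| < delta ->
    is_derive r (1 : R) (g^`(k))%classic ((g^`(k.+1))%classic r).
  move=> k4 rd; have [/(_ k k4) dk _] := dP r rd.
  by apply: DeriveDef => //=; rewrite derive1E.
have T3 (r : R) : `|r| < delta -> `|(g^`(3))%classic r| <= B * `|r| ^+ 1.
  apply: le_antiderivative g3 r => r rd; first exact: dg.
  by rewrite expr0 mulr1; case: (dP r rd).
have T2 (r : R) : `|r| < delta -> `|(g^`(2))%classic r - a| <= B * `|r| ^+ 2.
  apply: (le_antiderivative (phi := fun r => (g^`(2))%classic r - a) _ T3).
    move=> {}r rd; have ? := dg 2%N r isT rd.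
    by apply: is_derive_eq; rewrite subr0.
  exact: subrr.
have T1 (r : R) : `|r| < delta -> `|(g^`(1))%classic r - a * r| <= B * `|r| ^+ 3.
  apply: (le_antiderivative (phi := fun r => (g^`(1))%classic r - a * r) _ T2).
    move=> {}r rd; have ? := dg 1%N r isT rd.
    by apply: is_derive_eq; rewrite /GRing.scale/=; ring.
  by rewrite g1 mulr0 subr0.
have T0 (r : R) : `|r| < delta -> `|g r - a / 2 * r ^+ 2| <= B * `|r| ^+ 4.
  apply: (le_antiderivative (phi := fun r => g r - a / 2 * r ^+ 2) _ T1).
    move=> {}r rd; have ? := dg 0%N r isT rd.
    by apply: is_derive_eq; rewrite /GRing.scale/=; field.
  by rewrite g0 expr0n mulr0 subr0.
have r4 (r : R) : `|r| ^+ 4 = r ^+ 4 by rewrite -normrX; apply/normr_idP; exact: exprn_even_ge0.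
(* B serves for |r| < delta. For |r| >= delta the other two terms absorb g and the quadratic part
   separately, as 1 <= r^4 / delta^4 and r^2 <= r^4 / delta^2. *)
pose C := B + G / delta ^+ 4 + `|a| / 2 / delta ^+ 2.
exists C => [|r].
  by rewrite !addr_ge0// !mulr_ge0// invr_ge0 exprn_ge0// ltW.
have [rd|dr] := ltP `|r| delta.
  apply: le_trans (T0 r rd) _; rewrite r4 ler_wpM2r ?exprn_even_ge0//.
  by rewrite /C -addrA lerDl addr_ge0// !mulr_ge0// invr_ge0 exprn_ge0// ltW.
apply: le_trans (ler_normB _ _) _; rewrite normrM normrM !normfV.
rewrite /C !mulrDl -addrA; apply: ler_wpDl.
  by rewrite -mulrDl mulr_ge0 ?exprn_even_ge0.
have rr : delta ^+ 2 <= r ^+ 2 by rewrite -(real_normK (num_real r)) ler_pXn2r ?nnegrE// ltW.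
have rr4 : delta ^+ 4 <= r ^+ 4 by rewrite -r4 ler_pXn2r ?nnegrE// ltW.
apply: lerD.
  apply: le_trans (gG r) _.
  by rewrite -mulrA ler_peMr// mulrC ler_pdivlMr ?exprn_gt0// mul1r.
rewrite normr_nat (ger0_norm (sqr_ge0 r)) -(mulrA (`|a| / 2)) ler_wpM2l ?mulr_ge0//.
rewrite [r ^+ 4](exprM r 2 2) expr2 mulrA ler_peMl ?sqr_ge0//.
by rewrite mulrC ler_pdivlMr ?exprn_gt0// mul1r.
Qed.

End taylor.

(** * Rescaled bond integrals and the energy expansion *)

Section bond_energy.
Variables (R : realType) (n : nat).
Hypothesis hn : n = 2%N \/ n = 3%N.
Local Notation leb := (@lebesgue_measure R).
Local Notation omega := (unit_ball_volume R n).
Variables (J : R -> R) (M : R).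
Hypothesis hJ : influence_function J M.
Implicit Types (F : 'M[R]_n) (x y z : 'cV[R]_n) (eps : R).

Let n0 : (0 < n)%N. Proof. by case: hn => ->. Qed.

(* [J] is unconstrained on negative arguments; clamping them to 0 makes the
   function monotone, hence measurable, on the whole line. *)
Definition clamped_influence (q : R) : R := J (Num.max q 0).
Local Notation Jp := clamped_influence.

Let JpE q : 0 <= q -> Jp q = J q.
Proof. by move=> q0; rewrite /Jp max_l. Qed.

Let Jp_ge0 q : 0 <= Jp q.
Proof. by apply: (influence_ge0 hJ); rewrite le_max lexx orbT. Qed.

Let Jp_le q : Jp q <= M.
Proof.
rewrite -(influence_at0 hJ); apply: (influence_nonincreasing hJ).
- by rewrite in_itv/= lexx.
- by rewrite in_itv/= andbT le_max lexx orbT.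
- by rewrite le_max lexx orbT.
Qed.

Let Jp_eq0 q : 1 <= q -> Jp q = 0.
Proof. by move=> q1; apply: (influence_eq0 hJ); rewrite le_max q1. Qed.

Let measurable_Jp : measurable_fun setT Jp.
Proof.
apply: nonincreasing_measurable => // q r qr; apply: (influence_nonincreasing hJ).
- by rewrite in_itv/= andbT le_max lexx orbT.
- by rewrite in_itv/= andbT le_max lexx orbT.
- by rewrite ge_max !le_max qr lexx !orbT.
Qed.

Let M_ge0 : 0 <= M. Proof. exact: le_trans (Jp_ge0 0) (Jp_le 0). Qed.

(** The exponent n combines q^(n-1) from polar coordinates with the factor |y - x| in r^2. The bound
    J <= M on [0, 1] gives the finiteness behind the real-valued integral. *)
Lemma influence_moment :
  (\int[leb]_(q in `[0%R, +oo[) (Jp q * q * q ^+ n.-1)%:E =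
   (\int[leb]_(q in `[0%R, 1%R]) (q ^+ n * J q)%R)%:E)%E.
Proof.
have -> : (\int[leb]_(q in `[0%R, +oo[) (Jp q * q * q ^+ n.-1)%:E =
    \int[leb]_(q in `[0%R, 1%R]) (q ^+ n * J q)%:E)%E.
  rewrite [LHS]integral_mkcond [RHS]integral_mkcond; apply: eq_integral => q _.
  rewrite !patchE; have [|] := boolP (q \in `[0%R, 1%R]%classic);
      rewrite ?inE ?notin_setE/= in_itv/=.
    move=> /andP[q0 q1]; rewrite ifT ?inE/= ?in_itv/= ?q0//; congr (_%:E).
    by rewrite JpE// -(prednK n0) exprS/=; ring.
  move=> q01; case: ifPn => //; rewrite inE/= in_itv/= andbT => q0.
  by rewrite Jp_eq0 ?mul0r// leNgt; apply/negP => q1; apply: q01; rewrite q0 ltW.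
rewrite /Rintegral fineK// ge0_fin_numE; last first.
  apply: integral_ge0 => q; rewrite /= in_itv/= => /andP[q0 q1].
  by rewrite lee_fin mulr_ge0 ?exprn_ge0// (influence_ge0 hJ).
apply: (@le_lt_trans _ _ (\int[leb]_(q in `[0%R, 1%R]) (cst M%:E) q)%E); last first.
  rewrite integral_cst//= lebesgue_measure_itv/= lte_fin ltr01 oppr0 adde0 mule1.
  exact: ltry.
apply: ge0_le_integral => //.
- move=> q; rewrite /= in_itv/= => /andP[q0 q1].
  by rewrite lee_fin mulr_ge0 ?exprn_ge0// (influence_ge0 hJ).
- apply/measurable_EFinP; apply: (eq_measurable_fun (fun q : measurableTypeR R => q ^+ n * Jp q)).
    by move=> q; rewrite inE/= in_itv/= => /andP[q0 _]; rewrite JpE.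
  by apply: measurable_funTS; exact: measurable_funM.
- move=> q; rewrite /= in_itv/= => /andP[q0 q1]; rewrite lee_fin -JpE//.
  by rewrite -[leRHS]mul1r ler_pM ?exprn_ge0// exprn_ile1.
Qed.

(** The kernel without the indicator of Omega and with the clamped J, so that it is measurable on
    the whole space. *)
Definition bond_weight eps x y : R :=
  Jp (cV_norm (y - x) / eps) / (eps * (omega * eps ^+ n)).

Let bond_weight_ge0 eps x y : 0 < eps -> 0 <= bond_weight eps x y.
Proof.
by move=> e0; rewrite divr_ge0// !mulr_ge0 ?exprn_ge0 ?unit_ball_volume_ge0// ltW.
Qed.

Let measurable_sub x : measurable_fun setT (fun y => y - x).
Proof.
apply: measurable_cVP => i; under eq_fun do rewrite !mxE.
by apply: measurable_funB => //; exact: measurable_coor.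
Qed.

Let measurable_bond_weight eps x : measurable_fun setT (bond_weight eps x).
Proof.
apply: measurable_funM => //; apply: (measurableT_comp measurable_Jp).
apply: measurable_funM => //.
by apply: (measurableT_comp (@measurable_cV_norm R n)); exact: measurable_sub.
Qed.

Lemma integral_bond_weight eps x (psi : 'cV[R]_n -> R) : 0 < eps ->
  measurable_fun setT psi -> (forall z, 0 <= psi z) ->
  (\int[lebesgue_cV R n]_y (bond_weight eps x y * psi (y - x))%:E =
   \int[lebesgue_cV R n]_z (Jp (cV_norm z) * (psi (eps *: z) / (eps * omega)))%:E)%E.
Proof.
move=> e0 mpsi psi0.
rewrite (@ge0_integral_affine_cV R n x eps)//; last 2 first.
- apply/measurable_EFinP; apply: measurable_funM; first exact: measurable_bond_weight.
  by apply: (measurableT_comp mpsi); exact: measurable_sub.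
- by move=> y; rewrite lee_fin mulr_ge0// bond_weight_ge0.
rewrite -ge0_integralZl//; last 3 first.
- apply/measurable_EFinP; apply: measurable_funM.
    apply: measurableT_comp; first exact: measurable_bond_weight.
    exact: measurable_affine_cV.
  apply: (measurableT_comp mpsi).
  by apply: (measurableT_comp (@measurable_sub x)); exact: measurable_affine_cV.
- by move=> z _; rewrite lee_fin mulr_ge0// bond_weight_ge0.
- by rewrite lee_fin exprn_ge0// ltW.
apply: eq_integral => z _; rewrite -EFinM; congr (_%:E).
rewrite /bond_weight addrC addKr cV_normZ gtr0_norm//.
have -> : eps * cV_norm z / eps = cV_norm z by field; rewrite gt_eqF.
by field; rewrite !gt_eqF// ?exprn_gt0// unit_ball_volume_gt0.
Qed.

Lemma integral_bond_quadratic eps x F : 0 < eps -> F^T = F ->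
  (\int[lebesgue_cV R n]_y
     (bond_weight eps x y * (cV_norm (y - x) * strain_sqr F (y - x)))%:E =
   ((\int[leb]_(q in `[0%R, 1%R]) (q ^+ n * J q)%R) *
    (\tr F ^+ 2 + 2 * frobenius F ^+ 2) / (n%:R + 2))%:E)%E.
Proof.
move=> e0 Fsym.
rewrite (@integral_bond_weight eps x (fun v => cV_norm v * strain_sqr F v))//; last 2 first.
- by apply: measurable_funM; [exact: measurable_cV_norm|exact: measurable_strain_sqr].
- by move=> z; rewrite mulr_ge0 ?cV_norm_ge0 ?strain_sqr_ge0.
have oN0 : omega != 0 by rewrite gt_eqF// unit_ball_volume_gt0.
have n2N0 : (n%:R + 2 : R) != 0 by rewrite -(natrD _ _ 2) pnatr_eq0 addn2.
(* The factor eps of |eps z| has cancelled 1 / eps. Writing max(q, 0) for q makes the radial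
   function nonnegative on the whole line, as the polar formula requires. *)
transitivity (\int[lebesgue_cV R n]_z
    (Jp (cV_norm z) * Num.max (cV_norm z) 0 / omega * strain_sqr F z)%:E)%E.
  apply: eq_integral => z _; congr (_%:E).
  rewrite max_l ?cV_norm_ge0// cV_normZ gtr0_norm// strain_sqrZ//.
  by field; rewrite oN0 gt_eqF.
rewrite (@ge0_integral_radial_strain R n hn (fun q => Jp q * Num.max q 0 / omega))//; last 2 first.
- by apply: measurable_funM => //; apply: measurable_funM => //; exact: measurable_maxr.
- by move=> q; rewrite !mulr_ge0 ?invr_ge0 ?unit_ball_volume_ge0// le_max lexx orbT.
transitivity ((omega / (n%:R + 2) * (\tr F ^+ 2 + 2 * frobenius F ^+ 2))%:E *
  (omega^-1%:E * \int[leb]_(q in `[0%R, +oo[) (Jp q * q * q ^+ n.-1)%:E))%E.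
  congr (_ * _)%E; rewrite -ge0_integralZl//.
  - apply: eq_integral => q; rewrite inE/= in_itv/= andbT => q0.
    by rewrite max_l// -EFinM; congr (_%:E); ring.
  - apply/measurable_EFinP; apply: measurable_funTS.
    by apply: measurable_funM => //; exact: measurable_funM.
  - move=> q; rewrite /= in_itv/= andbT => q0.
    by rewrite lee_fin !mulr_ge0// exprn_ge0.
  - by rewrite lee_fin invr_ge0 unit_ball_volume_ge0.
rewrite influence_moment -!EFinM; congr (_%:E).
by field; rewrite oN0 n2N0.
Qed.

Lemma integral_bond_quartic_le eps x F : 0 < eps ->
  (\int[lebesgue_cV R n]_y
     (bond_weight eps x y * (cV_norm (y - x) * strain_sqr F (y - x)) ^+ 2)%:E <=
   (M * eps * frobenius F ^+ 4)%:E)%E.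
Proof.
move=> e0.
rewrite (@integral_bond_weight eps x (fun v => (cV_norm v * strain_sqr F v) ^+ 2))//; last 2 first.
- apply: measurable_funX.
  by apply: measurable_funM; [exact: measurable_cV_norm|exact: measurable_strain_sqr].
- by move=> z; exact: sqr_ge0.
have o0 : 0 < omega by exact: unit_ball_volume_gt0.
pose W z := Jp (cV_norm z) * ((cV_norm (eps *: z) * strain_sqr F (eps *: z)) ^+ 2 / (eps * omega)).
have WE z : W z = eps / omega * (Jp (cV_norm z) * cV_norm z ^+ 2 * strain_sqr F z ^+ 2).
  rewrite /W cV_normZ gtr0_norm// strain_sqrZ//.
  by field; rewrite !gt_eqF.
have -> : (\int[lebesgue_cV R n]_z (W z)%:E =
    \int[lebesgue_cV R n]_(z in cV_ball 0 1) (W z)%:E)%E.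
  rewrite [RHS]integral_mkcond; apply: eq_integral => z _.
  rewrite patchE; case: ifPn => //; rewrite notin_setE cV_ball01E /= => /negP.
  by rewrite -leNgt => z1; rewrite /W Jp_eq0// mul0r.
have -> : M * eps * frobenius F ^+ 4 = eps / omega * M * frobenius F ^+ 4 * omega.
  by field; rewrite gt_eqF.
apply: integral_le_ball.
  rewrite (funext WE).
  apply: measurable_funM => //; apply: measurable_funM; first apply: measurable_funM.
  - by apply: (measurableT_comp measurable_Jp); exact: measurable_cV_norm.
  - by apply: measurable_funX; exact: measurable_cV_norm.
  - by apply: measurable_funX; exact: measurable_strain_sqr.
move=> z; rewrite WE; apply/andP; split.
  apply: mulr_ge0; first by rewrite divr_ge0 ?ltW.
  by apply: mulr_ge0; [apply: mulr_ge0 => //; exact: sqr_ge0|exact: sqr_ge0].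
rewrite -(mulrA _ M) ler_pM2l ?divr_gt0//.
(* Inside the unit ball |z|^2 <= 1 and J <= M; beyond it J vanishes. *)
have JM : Jp (cV_norm z) * cV_norm z ^+ 2 <= M.
  have [z1|z1] := leP 1 (cV_norm z); first by rewrite Jp_eq0// mul0r.
  by rewrite -[leRHS]mulr1 ler_pM ?sqr_ge0// expr_le1 ?cV_norm_ge0// ltW.
apply: ler_pM => //; [by apply: mulr_ge0 => //; exact: sqr_ge0|exact: sqr_ge0|].
rewrite (exprM _ 2 2) ler_pXn2r ?nnegrE ?strain_sqr_ge0 ?sqr_ge0//.
exact: strain_sqr_le.
Qed.

Definition linear_scaled_strain F x y : R :=
  Num.sqrt (cV_norm (y - x)) *
  cV_dot (F *m direction (y - x)) (direction (y - x)).

Let linear_scaled_strain_sqr F x y :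
  linear_scaled_strain F x y ^+ 2 = cV_norm (y - x) * strain_sqr F (y - x).
Proof. by rewrite exprMn sqr_sqrtr ?cV_norm_ge0. Qed.

Let measurable_linear_scaled_strain F x : measurable_fun setT (linear_scaled_strain F x).
Proof.
apply: measurable_funM.
  apply: (measurableT_comp (f := @Num.sqrt R)).
    exact: (continuous_measurable_fun (@sqrt_continuous R)).
  by apply: (measurableT_comp (@measurable_cV_norm R n)); exact: measurable_sub.
have mdir : measurable_fun setT (fun y => direction (y - x)).
  by apply: (measurableT_comp (@measurable_direction R n)); exact: measurable_sub.
apply: measurable_cV_dot => //.
exact: (measurableT_comp (@measurable_mulmx R n F)).
Qed.

(** The pointwise remainder bound is integrated against the weight. Integrability of the energy
    integrand [P] is itself deduced from it: [P] is an integrable quadratic part plus an error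
    dominated by C [S]. *)
Lemma bond_energy_asymptotics (g : R -> R) (a C : R) :
  measurable_fun setT g -> 0 <= C ->
  (forall r, `|g r - a / 2 * r ^+ 2| <= C * r ^+ 4) ->
  forall eps x F, 0 < eps -> F^T = F ->
  (`| \int[lebesgue_cV R n]_y (bond_weight eps x y * g (linear_scaled_strain F x y))%:E -
     (a / 2 * ((\int[leb]_(q in `[0%R, 1%R]) (q ^+ n * J q)%R) *
       (\tr F ^+ 2 + 2 * frobenius F ^+ 2) / (n%:R + 2)))%:E |
   <= (C * M * eps * frobenius F ^+ 4)%:E)%E.
Proof.
move=> mg C0 gC eps x F e0 Fsym.
pose mu := lebesgue_cV R n.
pose r := linear_scaled_strain F x.
pose P y := bond_weight eps x y * g (r y).
pose Q y := bond_weight eps x y * r y ^+ 2.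
pose S y := bond_weight eps x y * r y ^+ 4.
have mr : measurable_fun setT r by exact: measurable_linear_scaled_strain.
have mP : measurable_fun setT P.
  by apply: measurable_funM; [exact: measurable_bond_weight|exact: measurableT_comp].
have mQ : measurable_fun setT Q.
  by apply: measurable_funM; [exact: measurable_bond_weight|exact: measurable_funX].
have mS : measurable_fun setT S.
  by apply: measurable_funM; [exact: measurable_bond_weight|exact: measurable_funX].
have Q0 y : 0 <= Q y by rewrite mulr_ge0 ?bond_weight_ge0 ?sqr_ge0.
have S0 y : 0 <= S y by rewrite mulr_ge0 ?bond_weight_ge0 ?exprn_even_ge0.
have intQ := integral_bond_quadratic x e0 Fsym.
have QE y : bond_weight eps x y * (cV_norm (y - x) * strain_sqr F (y - x)) = Q y.
  by rewrite /Q linear_scaled_strain_sqr.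
have intS := integral_bond_quartic_le x F e0.
have SE y : bond_weight eps x y * (cV_norm (y - x) * strain_sqr F (y - x)) ^+ 2 = S y.
  by rewrite /S (exprM _ 2 2) linear_scaled_strain_sqr.
move: intQ; under eq_integral do rewrite QE.
move=> intQ.
move: intS; under eq_integral do rewrite SE.
move=> intS.
have iQ : mu.-integrable setT (EFin \o Q).
  apply/integrableP; split; first exact/measurable_EFinP.
  under eq_integral do rewrite /= ger0_norm//.
  by rewrite intQ ltry.
have iS : mu.-integrable setT (EFin \o S).
  apply/integrableP; split; first exact/measurable_EFinP.
  under eq_integral do rewrite /= ger0_norm//.
  exact: le_lt_trans intS (ltry _).
have iaQ : mu.-integrable setT (fun y => (a / 2)%:E * (Q y)%:E)%E by exact: integrableZl.
have iCS : mu.-integrable setT (fun y => C%:E * (S y)%:E)%E by exact: integrableZl.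
have mPQ : measurable_fun setT (fun y => P y - a / 2 * Q y).
  by apply: measurable_funB => //; exact: measurable_funM.
have PQS y : `|P y - a / 2 * Q y| <= C * S y.
  have -> : P y - a / 2 * Q y = bond_weight eps x y * (g (r y) - a / 2 * r y ^+ 2).
    by rewrite /P /Q; ring.
  rewrite normrM ger0_norm ?bond_weight_ge0// /S (mulrCA C) ler_wpM2l ?bond_weight_ge0//.
have iPQ : mu.-integrable setT (fun y => (P y - a / 2 * Q y)%:E).
  apply: le_integrable iCS => //.
    by apply/measurable_EFinP; exact: mPQ.
  by move=> y _; rewrite /= lee_fin (le_trans (PQS y))// ler_norm.
have iP : mu.-integrable setT (EFin \o P).
  have -> : EFin \o P = (fun y => (P y - a / 2 * Q y)%:E + (a / 2)%:E * (Q y)%:E)%E.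
    by apply/funext => y; rewrite -EFinM -EFinD subrK.
  exact: integrableD.
rewrite EFinM -intQ -integralZl// -integralB//=.
apply: le_trans (le_abse_integral _ _ _) _ => //.
  by apply/measurable_EFinP; exact: mPQ.
apply: (@le_trans _ _ (\int[mu]_y (C%:E * (S y)%:E))%E).
  apply: ge0_le_integral => //.
  - by apply/measurable_EFinP; apply: measurableT_comp => //.
  - by apply/measurable_EFinP; exact: measurable_funM.
  - by move=> y _; rewrite -EFinM lee_fin; exact: PQS.
rewrite integralZl//.
have -> : C * M * eps * frobenius F ^+ 4 = C * (M * eps * frobenius F ^+ 4) by ring.
by rewrite EFinM lee_wpmul2l// lee_fin.
Qed.

End bond_energy.

Theorem mainTheorem9 (R : realType) (d : nat) (hd : d = 2%N \/ d = 3%N)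
    (Omega : set 'cV[R]_d) (hOmega : bounded_domain Omega)
    (J : R -> R) (M : R) (hJ : influence_function J M)
    (f g : R -> R) (rc rplus ginf : R) (hg : bond_potential f g rc rplus ginf) :
  exists C : R, forall (eps : R) (x : 'cV[R]_d) (F : 'M[R]_d)
    (gamma : (R -> 'cV[R]_d -> 'cV[R]_d) -> 'cV[R]_d -> 'cV[R]_d -> R -> R)
    (u : R -> 'cV[R]_d -> 'cV[R]_d) (t : R),
    0 < eps ->
    Omega x ->
    cV_ball x eps `<=` Omega ->
    F^T = F ->
    (forall v y z s, 0 <= gamma v y z s <= 1) ->
    (forall y, cV_ball x eps y -> gamma u y x t = 1) ->
    (forall y, cV_ball x eps y -> y != x ->
       let e := bond_direction y x in
       strain u t y x = cV_dot (F *m e) e /\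
       cV_dot (F *m e) e < critical_strain rc y x) ->
    energy_density Omega J g eps gamma t x u =
      (\int[lebesgue_cV R d]_(y in Omega)
        (nonlocal_kernel Omega J eps y x * g (scaled_strain u t y x))%:E)%E /\
    (`| energy_density Omega J g eps gamma t x u -
        (2 * lame_mu d J g * frobenius F ^+ 2 +
         lame_lambda d J g * `|\tr F| ^+ 2)%:E |
     <= (C * eps * frobenius F ^+ 4)%:E)%E.
Proof.
have g_meas : measurable_fun setT g.
  apply: continuous_measurable_fun => r; apply: differentiable_continuous.
  exact/derivable1_diffP/(potential_derivable hg).
have g0 : g 0 = 0 by rewrite (potentialE hg) expr0n (profile0 hg).
have [C C0 gC] := quartic_remainder (potential_bounded hg) g0 (potential_C4 hg)
  (potential_odd1 hg) (potential_odd3 hg).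
exists (C * M) => eps x F gamma u t e0 Ox ballO Fsym _ gamma1 strainF.
pose P y := bond_weight J eps x y * g (linear_scaled_strain F x y).
(* Stated for an arbitrary factor c in order to serve both the damage factor and the constant 1. *)
have integrandE (c : 'cV[R]_d -> R) : (forall y, cV_ball x eps y -> c y = 1) ->
    (\int[lebesgue_cV R d]_(y in Omega)
      (nonlocal_kernel Omega J eps y x * c y * g (scaled_strain u t y x))%:E =
     \int[lebesgue_cV R d]_y (P y)%:E)%E.
  move=> c1; rewrite integral_mkcond; apply: eq_integral => y _; rewrite patchE.
  have norm0 : 0 <= cV_norm (y - x) / eps by rewrite divr_ge0 ?cV_norm_ge0 ?ltW.
  (* Off the ball J vanishes, so both integrands are 0 whether or not y lies in Omega. *)
  have [yB|yB] := ltP (cV_norm (y - x)) eps; last first.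
    have J0 : J (cV_norm (y - x) / eps) = 0.
      by apply: (influence_eq0 hJ); rewrite ler_pdivlMr// mul1r.
    rewrite /P /bond_weight /clamped_influence max_l// /nonlocal_kernel J0.
    by rewrite mulr0 !mul0r if_same.
  have yO : y \in Omega by rewrite inE; exact: ballO.
  rewrite yO c1//; congr (_%:E); rewrite mulr1 /P; congr (_ * g _).
    rewrite /nonlocal_kernel /bond_weight /clamped_influence max_l//.
    by rewrite indicE yO mul1r.
  rewrite /scaled_strain /linear_scaled_strain; congr (_ * _).
  (* At y = x the hypothesis gives nothing, but both strains are 0 by the convention on inverses. *)
  have [->|yx] := eqVneq y x; last by have [] := strainF y yB yx.
  rewrite /strain /bond_direction !subrr direction0 !scaler0 mulmx0.
  by rewrite /cV_dot.
have energyE : energy_density Omega J g eps gamma t x u =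
    (\int[lebesgue_cV R d]_y (P y)%:E)%E.
  exact: (integrandE (fun y => gamma u y x t)).
split.
  rewrite energyE -(integrandE (fun=> 1))//; apply: eq_integral => y _.
  by rewrite mulr1.
have -> : 2 * lame_mu d J g * frobenius F ^+ 2 + lame_lambda d J g * `|\tr F| ^+ 2 =
    (g^`(2))%classic 0 / 2 * ((\int[@lebesgue_measure R]_(q in `[0%R, 1%R]) (q ^+ d * J q)%R) *
       (\tr F ^+ 2 + 2 * frobenius F ^+ 2) / (d%:R + 2)).
  (* The constant 1 / (2 (d + 2)) is 1/8 for d = 2 and 1/10 for d = 3. *)
  rewrite /lame_lambda real_normK ?num_real// /lame_mu.
  by move: (frobenius F) (\tr F) => norm_F tr_F; clear -hd; case: hd => ->; field.
rewrite energyE.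
exact: (bond_energy_asymptotics hd hJ g_meas C0 gC x e0 Fsym).
Qed.
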